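(* Let $n\ge 1$ be an integer, let $Q=[a,b]\times[c,d]$ and let $f:Q\to\mathbb{R}$ have continuous partial derivatives of order $n-1$. Suppose that the $n$-th partial derivatives $D^n_jf=\frac{\partial^n f}{\partial t^{n-j}\partial s^{j}}$, $j=0,1,\dots,n$, are absolutely continuous on $Q$. For $k\in\{0,1,\dots,n\}$ write $D^{n+1}f:=\frac{\partial^2}{\partial t\,\partial s}\big(D^n_kf\big)$ (defined almost everywhere on $Q$), and for $(x,y)\in Q$ put $$\mathcal{B}_n(f,Q)=\frac{1}{(b-a)(d-c)}\int_c^d\int_a^b S_n(x,t;y,s)\,d_td_s\big(D^n_kf(t,s)\big),$$ with the kernel $S_n$ defined in the context. Then for every $(x,y)\in Q$ and every $k\in\{0,1,\dots,n\}$ the following hold. (i) If $D^{n+1}f\in L_\infty(Q)$, then $$|\mathcal{B}_n(f,Q)|\le\frac{\big[(b-x)(x-a)^{n+1}+(x-a)(b-x)^{n+1}\big]\big[(d-y)(y-c)^{n+1}+(y-c)(d-y)^{n+1}\big]}{n!\,(n+1)^2(b-a)(d-c)}\,\big\|D^{n+1}f\big\|_{Q,\infty}.$$ (ii) If $p>1$, $\frac1p+\frac1q=1$ and $D^{n+1}f\in L_p(Q)$, then $$|\mathcal{B}_n(f,Q)|\le\frac{\big[(b-x)(x-a)^{n+1/q}+(x-a)(b-x)^{n+1/q}\big]\big[(d-y)(y-c)^{n+1/q}+(y-c)(d-y)^{n+1/q}\big]}{n!\,(nq+1)^{1/q}(b-a)(d-c)}\,\big\|D^{n+1}f\big\|_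{Q,p}.$$
   Context: Here $a<b$, $c<d$ are real numbers and $Q=[a,b]\times[c,d]$. A function $g:Q\to\mathbb{R}$ is absolutely continuous on $Q$ (Carathéodory sense) if there are integrable functions $\alpha\in L_1[a,b]$, $\beta\in L_1[c,d]$, $\gamma\in L_1(Q)$ with $g(t,s)=g(a,c)+\int_a^t\alpha+\int_c^s\beta+\int_c^s\int_a^t\gamma$ for all $(t,s)\in Q$; then $\frac{\partial^2 g}{\partial t\partial s}=\gamma$ almost everywhere. For a grid partition $a=x_0<\dots<x_N=b$, $c=y_0<\dots<y_M=d$ of $Q$ put $\Delta_{11}g(x_i,y_j)=g(x_{i-1},y_{j-1})-g(x_{i-1},y_j)-g(x_i,y_{j-1})+g(x_i,y_j)$. The integral $\int_c^d\int_a^b h(t,s)\,d_td_s\,g(t,s)$ is the Riemann--Stieltjes double integral, i.e. the limit, as the mesh of the partition tends to $0$, of the sums $\sum_{i,j}h(\xi_{ij},\eta_{ij})\,\Delta_{11}g(x_i,y_j)$ with $(\xi_{ij},\eta_{ij})\in[x_{i-1},x_i]\times[y_{j-1},y_j]$. $\|\cdot\|_{Q,\infty}$ and $\|\cdot\|_{Q,p}$ are the usual norms of $L_\infty(Q)$ and $L_p(Q)$ for Lebesgue measure. For $(x,y)\in Q$ the kernel is $$S_n(x,t;y,s)=\frac{1}{n!}\begin{cases}(x-t)^n(b-x)(y-s)^n(d-y), & a\le t\le x,\ c\le s\le y,\\ (-1)^{n+1}(t-x)^n(x-a)(y-s)^n(d-y), & x<t\le b,\ c\le s\le y,\\ (-1)^{n+1}(x-t)^n(b-x)(s-y)^n(y-c),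 & a\le t\le x,\ y<s\le d,\\ (t-x)^n(x-a)(s-y)^n(y-c), & x<t\le b,\ y<s\le d.\end{cases}$$ *)

(* Defs.v *)
From HB Require Import structures.
From mathcomp Require Import all_boot all_order all_algebra.
From mathcomp Require Import all_classical all_reals all_analysis.

Set Implicit Arguments.
Unset Strict Implicit.
Unset Printing Implicit Defensive.

Import Order.TTheory GRing.Theory Num.Theory.
Import numFieldNormedType.Exports.

Local Open Scope classical_set_scope.
Local Open Scope ring_scope.

(* A function g : Q -> R is represented by a total function on R * R; every
   definition below depends only on its values on Q. *)
Definition rect (R : realType) (a b c d : R) : set (R * R) :=
  `[a, b]%classic `*` `[c, d]%classic.

Section partial_derivatives.
Context {R : realType}.
Variable Q : set (R * R).

Inductive var := Vt | Vs.

Definition var_dir (v : var) : R * R :=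
  match v with Vt => (1, 0) | Vs => (0, 1) end.

(* Same difference quotient as the library's [derive], but only increments that
   stay in Q are considered: one-sided derivatives on the boundary of Q. *)
Definition pderivable1 (v : var) (f : R * R -> R) (z : R * R) : Prop :=
  cvg ((fun h : R => h^-1 * (f (h *: var_dir v + z) - f z))
         @ within [set h : R | Q (h *: var_dir v + z)] 0^').

Definition pderiv1 (v : var) (f : R * R -> R) (z : R * R) : R :=
  lim ((fun h : R => h^-1 * (f (h *: var_dir v + z) - f z))
         @ within [set h : R | Q (h *: var_dir v + z)] 0^').

(* Words are read like the denominator of d^m / (dv_1 ... dv_m): the last
   letter is the first variable of differentiation. *)
Fixpoint pderiv (w : seq var) (f : R * R -> R) : R * R -> R :=
  if w is v :: w' then pderiv1 v (pderiv w' f) else f.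

Fixpoint pderivable (w : seq var) (f : R * R -> R) : Prop :=
  if w is v :: w' then
    pderivable w' f /\ forall z, Q z -> pderivable1 v (pderiv w' f) z
  else True.

Definition continuous_partials (m : nat) (f : R * R -> R) : Prop :=
  forall w : seq var, size w = m ->
    pderivable w f /\ {within Q, continuous (pderiv w f)}.

(* d^n / (dt^(n-j) ds^j) *)
Definition Dword (n j : nat) : seq var := nseq (n - j) Vt ++ nseq j Vs.

Definition Dnj (n j : nat) (f : R * R -> R) : R * R -> R :=
  pderiv (Dword n j) f.

(* d^2 / (dt ds) of Dnj n k f; at points of Q where this derivative does not
   exist the value is the junk value of [lim]. *)
Definition Dn1 (n k : nat) (f : R * R -> R) : R * R -> R :=
  pderiv [:: Vt; Vs] (Dnj n k f).

End partial_derivatives.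

Section Lebesgue.
Context {R : realType}.
Local Notation mu := (@lebesgue_measure R).

Definition leb2 :
    {measure set (measurableTypeR R * measurableTypeR R) -> \bar R} :=
  (mu \x mu)%E.

(* Absolute continuity on [a, b] x [c, d] in the sense of Caratheodory. *)
Definition abs_cont (a b c d : R) (g : R * R -> R) : Prop :=
  exists (alpha beta : R -> R) (gamma : R * R -> R),
    [/\ mu.-integrable `[a, b] (EFin \o alpha),
        mu.-integrable `[c, d] (EFin \o beta),
        leb2.-integrable (rect a b c d) (EFin \o gamma) &
        forall t s, rect a b c d (t, s) ->
          g (t, s) = g (a, c) + \int[mu]_(u in `[a, t]) alpha u
                     + \int[mu]_(v in `[c, s]) beta v
                     + \int[mu]_(v in `[c, s]) \int[mu]_(u in `[a, t])
                         gamma (u, v)].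

Definition LnormQ (Q : set (R * R)) (p : \bar R) (h : R * R -> R) : \bar R :=
  'N[leb2]_p[EFin \o (h \_ Q)]%E.

(* h need only be defined a.e. on Q. The sigma-algebra of the library is the
   Borel one, whence Lebesgue measurability is expressed as a.e. equality with a
   (Borel) measurable function. *)
Definition LpQ (Q : set (R * R)) (p : \bar R) (h : R * R -> R) : Prop :=
  (exists2 h' : R * R -> R, measurable_fun Q h' & h = h' %[ae leb2 in Q])
  /\ (LnormQ Q p h < +oo)%E.

End Lebesgue.

Section Stieltjes.
Context {R : realType}.
Variables a b c d : R.

(* The partition a = x_0 < ... < x_N = b is given by xs = [:: x_1; ...; x_N]
   (see [itv_partition]), so that x_i is [node a xs i]. *)
Definition node (a : R) (xs : seq R) (i : nat) : R := nth a (a :: xs) i.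

Definition mesh_lt (a : R) (xs : seq R) (delta : R) : Prop :=
  forall i, (i < size xs)%N -> node a xs i.+1 - node a xs i < delta.

(* Cells are numbered from 0: cell (i, j) is
   [x_i, x_(i+1)] x [y_j, y_(j+1)]. *)
Definition Delta11 (g : R * R -> R) (xs ys : seq R) (i j : nat) : R :=
  g (node a xs i, node c ys j) - g (node a xs i, node c ys j.+1)
  - g (node a xs i.+1, node c ys j) + g (node a xs i.+1, node c ys j.+1).

Definition tags (xs ys : seq R) (xi : nat -> nat -> R * R) : Prop :=
  forall i j, (i < size xs)%N -> (j < size ys)%N ->
    rect (node a xs i) (node a xs i.+1) (node c ys j) (node c ys j.+1) (xi i j).

Definition RS_sum (h g : R * R -> R) (xs ys : seq R)
    (xi : nat -> nat -> R * R) : R :=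
  \sum_(i < size xs) \sum_(j < size ys) h (xi i j) * Delta11 g xs ys i j.

Definition is_RSint (h g : R * R -> R) (I : R) : Prop :=
  forall e : R, 0 < e -> exists2 delta : R, 0 < delta &
    forall (xs ys : seq R) (xi : nat -> nat -> R * R),
      itv_partition a b xs -> itv_partition c d ys ->
      mesh_lt a xs delta -> mesh_lt c ys delta -> tags xs ys xi ->
      `|RS_sum h g xs ys xi - I| < e.

Definition RS_integrable (h g : R * R -> R) : Prop :=
  exists I : R, is_RSint h g I.

(* Junk value when the integral does not exist. *)
Definition RSint (h g : R * R -> R) : R := get (is_RSint h g).

Definition Sn (n : nat) (x y : R) (z : R * R) : R :=
  let: (t, s) := z in
  (n`!%:R)^-1 *
  (if t <= x then
     if s <= y then (x - t) ^+ n * (b - x) * (y - s) ^+ n * (d - y)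
     else (-1) ^+ n.+1 * (x - t) ^+ n * (b - x) * (s - y) ^+ n * (y - c)
   else
     if s <= y then (-1) ^+ n.+1 * (t - x) ^+ n * (x - a) * (y - s) ^+ n * (d - y)
     else (t - x) ^+ n * (x - a) * (s - y) ^+ n * (y - c)).

Definition Bn (n k : nat) (f : R * R -> R) (x y : R) : R :=
  ((b - a) * (d - c))^-1 * RSint (Sn n x y) (Dnj (rect a b c d) n k f).

End Stieltjes.

(* Main.v *)
Require Import Defs.
From mathcomp Require Import all_boot all_order all_algebra.
From mathcomp Require Import all_classical all_reals all_analysis.
Import Order.TTheory GRing.Theory Num.Theory.
Import numFieldNormedType.Exports.
From mathcomp Require Import measurable_realfun ess_sup_inf ring lra.
Local Open Scope classical_set_scope.
Local Open Scope ring_scope.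

Set Implicit Arguments.
Unset Strict Implicit.
Unset Printing Implicit Defensive.

(** Let G be the n-th partial derivative D^n_k f. By hypothesis G is a sum of a
    function of t, a function of s and the integral of a density g over
    [a, t] x [c, s]. The mixed difference of G over a cell is therefore the
    integral of g over that cell ([Delta11_density]). As n >= 1, the kernel S_n is
    continuous on Q: up to n! it is a product of Lipschitz kernels of one variable
    ([Sn_kernel1]). Hence the Stieltjes sums of S_n against G converge to the
    Lebesgue integral of S_n g over Q ([is_RSint_density]); in particular the
    Stieltjes integral exists.

    The two bounds are then Hoelder's inequality, with the pairs of exponents
    (1, oo) and (q, p). The L_q norm of the kernel factorizes, and each factor
    is an explicit integral of powers over the two sides of x or y
    ([integral_kernel1_powR]). For q > 1 the two sides are separated by the
    subadditivity of the q-th root ([kernel1_moment_root]). Both variables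
    contribute a factor (n q + 1) ^ (1/q) to the denominator; the stated
    inequality keeps only one of them.

    It remains to identify the norm of g with that of the mixed derivative of G,
    which is an iterated limit of difference quotients. The delicate point is
    that the outer quotient, taken in t, needs the inner derivative, taken in s,
    at all t near a given one. Lebesgue differentiation gives the inner
    derivative for almost every s, with a null set depending on t. For g >= 0
    the inner quotient is monotone in t, so that rational t suffice
    ([monotone_slopes]), and a single null set of s works for all t; the general
    case follows by splitting g into its positive and negative parts
    ([ae_slope_primitive]). Outside that null set the inner derivative is an
    indefinite integral in t, which is differentiated once more
    ([ae_mixed_derivative]). Finally, measurability of the mixed derivative up
    to a null set, part of its membership in L_p, allows the slices to be
    reassembled by Fubini's theorem ([ae_mixed_derivative_density]). *)

(** * Integrals over quadrants and cells *)

Lemma setXUl T1 T2 (A B : set T1) (C : set T2) :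
  (A `|` B) `*` C = (A `*` C) `|` (B `*` C).
Proof. by apply/seteqP; split => z /=; tauto. Qed.

Lemma setXUr T1 T2 (A : set T1) (B C : set T2) :
  A `*` (B `|` C) = (A `*` B) `|` (A `*` C).
Proof. by apply/seteqP; split => z /=; tauto. Qed.

Section primitive.
Context {R : realType}.
Local Notation mu := (@lebesgue_measure R).
Local Notation R2 := (measurableTypeR R * measurableTypeR R)%type.
Implicit Types (F : R2 -> R) (t s : R).

(** Starting the integration at -oo turns every interval and cell integral into a
    difference of values of one function, with no case distinction on the
    position of the end points; the integrands of interest vanish off Q. *)
Definition primitive F (t s : R) : R :=
  \int[leb2]_(z in `]-oo, t] `*` `]-oo, s]) F z.

Lemma measurable_box (i j : interval R) :
  measurable ([set` i] `*` [set` j] : set R2).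
Proof. by apply: measurableX; exact: measurable_itv. Qed.

Lemma integrable_box F (i j : interval R) :
  leb2.-integrable setT (EFin \o F) ->
  leb2.-integrable ([set` i] `*` [set` j]) (EFin \o F).
Proof.
by move=> iF; apply: integrableS iF => //; exact: measurable_box.
Qed.

Lemma Rintegral_box_splitl F (t t' : R) (j : interval R) :
  leb2.-integrable setT (EFin \o F) -> t <= t' ->
  \int[leb2]_(z in `]-oo, t'] `*` [set` j]) F z =
  \int[leb2]_(z in `]-oo, t] `*` [set` j]) F z
  + \int[leb2]_(z in `]t, t'] `*` [set` j]) F z.
Proof.
move=> iF tt'.
have -> : `]-oo, t']%classic = `]-oo, t]%classic `|` `]t, t']%classic.
  by rewrite -itv_bndbnd_setU// bnd_simp.
rewrite setXUl Rintegral_setU//; try exact: measurable_box.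
- apply: integrableS iF => //; apply: measurableU; exact: measurable_box.
- apply/disj_setPS => -[u v] /= [[]]; rewrite !in_itv/= => ut _ [/andP[tu _] _].
  by move: (lt_le_trans tu ut); rewrite ltxx.
Qed.

Lemma Rintegral_box_splitr F (s s' : R) (i : interval R) :
  leb2.-integrable setT (EFin \o F) -> s <= s' ->
  \int[leb2]_(z in [set` i] `*` `]-oo, s']) F z =
  \int[leb2]_(z in [set` i] `*` `]-oo, s]) F z
  + \int[leb2]_(z in [set` i] `*` `]s, s']) F z.
Proof.
move=> iF tt'.
have -> : `]-oo, s']%classic = `]-oo, s]%classic `|` `]s, s']%classic.
  by rewrite -itv_bndbnd_setU// bnd_simp.
rewrite setXUr Rintegral_setU//; try exact: measurable_box.
- apply: integrableS iF => //; apply: measurableU; exact: measurable_box.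
- apply/disj_setPS => -[u v] /= [[_]]; rewrite !in_itv/= => ut [_ /andP[tu _]].
  by move: (lt_le_trans tu ut); rewrite ltxx.
Qed.

Lemma primitive_cell F (t t' s s' : R) :
  leb2.-integrable setT (EFin \o F) -> t <= t' -> s <= s' ->
  primitive F t s - primitive F t s' - primitive F t' s + primitive F t' s'
  = \int[leb2]_(z in `]t, t'] `*` `]s, s']) F z.
Proof.
move=> iF tt' ss'; rewrite /primitive.
rewrite [X in _ + X](Rintegral_box_splitl _ iF tt').
rewrite [X in _ - X + _](Rintegral_box_splitl _ iF tt').
rewrite [X in _ + (_ + X)](Rintegral_box_splitr _ iF ss').
by ring.
Qed.

End primitive.

Section iterated.
Context {R : realType}.
Local Notation mu := (@lebesgue_measure R).
Local Notation R2 := (measurableTypeR R * measurableTypeR R)%type.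
Implicit Types (F : R2 -> R) (t s : R).

Lemma ae_integrable_slice F : leb2.-integrable setT (EFin \o F) ->
  {ae mu, forall v, mu.-integrable setT (fun u => (F (u, v))%:E)}.
Proof. by move=> iF; exact: (ae_integrable2 iF). Qed.

(** The inner integral of an iterated real-valued integral has a junk value on
    the slices where the function is not integrable. These slices form a null
    set, so the extended-real Fubini theorem carries over. *)
Lemma fubini_G_Rintegral F : leb2.-integrable setT (EFin \o F) ->
  ae_eq mu setT (fun v => (\int[mu]_u F (u, v))%:E)
                (fubini_G mu (EFin \o F)).
Proof.
move=> iF; have := ae_integrable_slice iF.
apply: filterS => v iFv _; rewrite /Rintegral fineK//.
exact: integrable_fin_num.
Qed.

Lemma measurable_slice_Rintegral F : leb2.-integrable setT (EFin \o F) ->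
  measurable_fun setT (fun v => \int[mu]_u F (u, v)).
Proof.
move=> iF.
have mG := measurable_fubini_G iF.
exact: (measurableT_comp (fine_measurable measurableT) mG).
Qed.

Lemma integrable_slice_Rintegral F : leb2.-integrable setT (EFin \o F) ->
  mu.-integrable setT (EFin \o (fun v => \int[mu]_u F (u, v))).
Proof.
move=> iF.
have mF : measurable_fun setT (EFin \o (fun v => \int[mu]_u F (u, v))).
  by apply/measurable_EFinP; exact: measurable_slice_Rintegral.
apply/integrableP; split => //.
have mF2 := measurable_int _ iF.
have mA : measurable_fun setT (abse \o (EFin \o F)) by exact: measurableT_comp.
have mS := measurable_fun_fubini_tonelli_G (m1 := mu)
  (abse \o (EFin \o F)) mA (fun=> abse_ge0 _).
have lty := (integrable21ltyP mu mu mF2).1 iF.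
apply: (le_lt_trans _ lty).
apply: ge0_le_integral => //; first exact: measurableT_comp.
move=> v _; rewrite /Rintegral/=.
apply: (@le_trans _ _ `|\int[mu]_u (F (u, v))%:E|%E).
  by case: (\int[mu]_u (F (u, v))%:E)%E => //=; rewrite leey.
apply: le_abse_integral => //.
exact: measurable_fun_pair1 mF2.
Qed.

Lemma Rintegral_slices F : leb2.-integrable setT (EFin \o F) ->
  \int[mu]_v \int[mu]_u F (u, v) = \int[leb2]_z F z.
Proof.
move=> iF; rewrite {1}/Rintegral [RHS]/Rintegral; congr fine.
rewrite -(integral21_prod_meas1 iF).
apply: ae_eq_integral => //; last exact: fubini_G_Rintegral.
- by apply/measurable_EFinP; exact: measurable_slice_Rintegral.
- exact: (measurable_fubini_G iF).
Qed.

Lemma primitive_iterated F t s : leb2.-integrable setT (EFin \o F) ->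
  primitive F t s =
  \int[mu]_(v in `]-oo, s]) \int[mu]_(u in `]-oo, t]) F (u, v).
Proof.
move=> iF; rewrite /primitive Rintegral_mkcond -Rintegral_slices; last first.
  rewrite -restrict_EFin.
  apply/(integrable_mkcond (EFin \o F) (measurable_box _ _)).
  exact: integrable_box.
rewrite [RHS]Rintegral_mkcond; apply: eq_Rintegral => v _.
rewrite patchE; case: ifPn => vs.
  rewrite [RHS]Rintegral_mkcond; apply: eq_Rintegral => u _.
  by rewrite !patchE in_setX/= vs andbT.
rewrite (@eq_Rintegral _ _ _ _ _ (cst 0)); first by rewrite /Rintegral integral0.
by move=> u _; rewrite patchE in_setX/= (negbTE vs) andbF.
Qed.

End iterated.

(** * Almost everywhere differentiation of the quadrant integral *)

Section differentiation.
Context {R : realType}.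
Local Notation mu := (@lebesgue_measure R).
Local Notation R2 := (measurableTypeR R * measurableTypeR R)%type.
Implicit Types (F : R2 -> R) (t s : R).

(** The quotient has the exact shape of the one defining the partial derivatives
    on Q, which use the same filter restricted to the increments staying in Q. *)
Definition has_slope (f : R -> R) (x l : R) : Prop :=
  (fun h : R => h^-1 * (f (h + x) - f x)) @ 0^' --> l.

Lemma has_slopeB (f g : R -> R) (x l m : R) :
  has_slope f x l -> has_slope g x m -> has_slope (f \- g) x (l - m).
Proof.
move=> fl gm; rewrite /has_slope (_ : (fun _ => _) =
  (fun h => h^-1 * (f (h + x) - f x)) \- (fun h => h^-1 * (g (h + x) - g x))).
  exact: cvgB.
by apply/funext => h/=; ring.
Qed.

Lemma has_slopeD (f g : R -> R) (x l m : R) :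
  has_slope f x l -> has_slope g x m -> has_slope (f \+ g) x (l + m).
Proof.
move=> fl gm; rewrite /has_slope (_ : (fun _ => _) =
  (fun h => h^-1 * (f (h + x) - f x)) \+ (fun h => h^-1 * (g (h + x) - g x))).
  exact: cvgD.
by apply/funext => h/=; ring.
Qed.

Lemma ae_slope_integral (f : R -> R) : mu.-integrable setT (EFin \o f) ->
  {ae mu, forall x, has_slope (fun y => \int[mu]_(u in `]-oo, y]) f u) x (f x)}.
Proof.
move=> intf.
have loc : locally_integrable setT f.
  have -> : f = f \_ setT by apply/funext => x; rewrite patchE mem_setT.
  exact: integrable_locally.
have iy y : mu.-integrable `]-oo, y] (EFin \o f) by exact: integrableS intf.
have := FTC1Ny iy loc; apply: filterS.
  exact: (ae_filter_ringOfSetsType mu).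
move=> x [dx <-].
rewrite /has_slope derive1E; move: dx; rewrite /derivable /derive.
set q := (q in cvg (q @ _)); set p := (p in _ -> p @ _ --> _).
suff -> : p = q by [].
by apply/funext => h; rewrite /q /= [h *: _]mulr1.
Qed.

Lemma continuous_integralNy (f : R -> R) : mu.-integrable setT (EFin \o f) ->
  continuous (fun y => \int[mu]_(u in `]-oo, y]) f u).
Proof.
move=> intf x; have lt2 : x - 1 < x + 1 by lra.
have int2 : mu.-integrable `[x - 1, x + 1] (EFin \o f) by exact: integrableS intf.
have := parameterized_integral_continuous (ltW lt2) int2.
move=> /(continuous_within_itvP _ lt2)[/(_ x)].
rewrite in_itv/= ltrBlDr !ltrDl ltr01 => /(_ isT) cx _ _.
pose c := \int[mu]_(u in `]-oo, x - 1]) f u.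
have E y : x - 1 <= y ->
    \int[mu]_(u in `]-oo, y]) f u = c + \int[mu]_(u in `[x - 1, y]) f u.
  move=> xy; rewrite -(Rintegral_itv_obnd_cbnd (f := f)); last first.
    exact: integrableS intf.
  rewrite -(@Rintegral_itvB _ f -oo%O (BRight y) (x - 1)).
  - by rewrite addrC subrK.
  - exact: integrableS intf.
  - by [].
  - by rewrite bnd_simp.
rewrite /continuous_at E; last by lra.
apply: cvg_trans (cvgD (cvg_cst c) cx).
apply: near_eq_cvg; near=> y; rewrite /= E//.
by near: y; exists 1 => /= [|z]; [exact: ltr01|rewrite /= /ball_ /= ltr_distl; lra].
Unshelve. all: by end_near. Qed.

(** Squeezing: a quotient monotone in the parameter t whose limit is known at
    rational parameters lies between the quotients at two rationals around t,
    and continuity of the limit closes the gap. *)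
Lemma monotone_slopes (q : R -> R -> R) (phi : R -> R) (t : R) :
  (forall h, h != 0 -> {homo q^~ h : t t' / t <= t'}) ->
  (forall r : rat, q (ratr r) h @[h --> 0^'] --> phi (ratr r)) ->
  {for t, continuous phi} ->
  q t h @[h --> 0^'] --> phi t.
Proof.
move=> qmono qr ct; apply/cvgrPdist_lt => e e0.
have e20 : 0 < e / 2 by rewrite divr_gt0.
move/cvgrPdist_lt : ct => /(_ _ e20) [del /= del0 hdel].
have [r1 r1t] := @rat_in_itvoo R (t - del) t ltac:(lra).
have [r2 r2t] := @rat_in_itvoo R t (t + del) ltac:(lra).
move: r1t r2t; rewrite !in_itv/= => /andP[r1a r1b] /andP[r2a r2b].
have p1 := hdel (ratr r1) ltac:(rewrite /ball/= ltr_norml; lra).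
have p2 := hdel (ratr r2) ltac:(rewrite /ball/= ltr_norml; lra).
have := qr r1 => /cvgrPdist_lt/(_ _ e20) c1.
have := qr r2 => /cvgrPdist_lt/(_ _ e20) c2.
near=> h.
have h0 : h != 0 by near: h; exact: nbhs_dnbhs_neq.
have l1 := qmono h h0 _ _ (ltW r1b).
have l2 := qmono h h0 _ _ (ltW r2a).
have d1 : `|phi (ratr r1) - q (ratr r1) h| < e / 2 by near: h.
have d2 : `|phi (ratr r2) - q (ratr r2) h| < e / 2 by near: h.
move: p1 p2 d1 d2 l1 l2; rewrite /= !ltr_norml; lra.
Unshelve. all: by end_near. Qed.

(** For one fixed t, the quadrant integral is an indefinite integral in s, so
    the one-variable differentiation theorem applies. The exceptional null set
    depends on t; removing this dependence is the point of the lemmas below. *)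
Lemma primitive_slope_row F t : leb2.-integrable setT (EFin \o F) ->
  {ae mu, forall s, has_slope (primitive F t) s
                      (\int[mu]_(u in `]-oo, t]) F (u, s))}.
Proof.
move=> iF.
pose Ft := F \_ (`]-oo, t] `*` [set` `]-oo, +oo[]).
have iFt : leb2.-integrable setT (EFin \o Ft).
  rewrite -restrict_EFin.
  apply/(integrable_mkcond (EFin \o F) (measurable_box _ _)).
  exact: integrable_box.
have slE s : \int[mu]_u Ft (u, s) = \int[mu]_(u in `]-oo, t]) F (u, s).
  rewrite [RHS]Rintegral_mkcond; apply: eq_Rintegral => u _.
  by rewrite /Ft !patchE in_setX/= [X in _ && X]mem_set ?andbT// in_itv.
have := ae_slope_integral (integrable_slice_Rintegral iFt).
apply: filterS; first exact: (ae_filter_ringOfSetsType mu).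
move=> s; rewrite slE.
rewrite (_ : primitive F t =
  (fun y => \int[mu]_(v in `]-oo, y]) \int[mu]_u Ft (u, v)))//.
apply/funext => y; rewrite primitive_iterated//.
by apply: eq_Rintegral => v _; rewrite slE.
Qed.

(** The difference of two quotients is the integral of F over a cell divided by
    the side |h|, whatever the sign of h. *)
Lemma le_primitive_quotient F s h : (forall z, 0 <= F z) ->
  leb2.-integrable setT (EFin \o F) -> h != 0 ->
  {homo (fun t => h^-1 * (primitive F t (h + s) - primitive F t s)) :
     t t' / t <= t'}.
Proof.
move=> F0 iF h0 t t' tt'.
have [h_gt0|h_lt0|h00] := ltrgtP h 0; last by rewrite h00 eqxx in h0.
- have le : h + s <= s by lra.
  have := primitive_cell iF tt' le.
  have : 0 <= \int[leb2]_(z in `]t, t'] `*` `]h + s, s]) F z.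
    exact: Rintegral_ge0.
  move=> + E; rewrite -E => c0.
  rewrite -subr_ge0 -mulrBr mulr_le0// ?invr_le0 ?(ltW h_gt0)//; lra.
- have le : s <= h + s by lra.
  have := primitive_cell iF tt' le.
  have : 0 <= \int[leb2]_(z in `]t, t'] `*` `]s, h + s]) F z.
    exact: Rintegral_ge0.
  move=> + E; rewrite -E => c0.
  rewrite -subr_ge0 -mulrBr mulr_ge0// ?invr_ge0 ?(ltW h_lt0)//; lra.
Qed.

(** One null set serves for all t: the countable union of the null sets of the
    rational t suffices, by monotonicity and continuity in t. *)
Lemma ge0_ae_slope_primitive F : (forall z, 0 <= F z) ->
  leb2.-integrable setT (EFin \o F) ->
  {ae mu, forall s, forall t, has_slope (primitive F t) s
                      (\int[mu]_(u in `]-oo, t]) F (u, s))}.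
Proof.
move=> F0 iF.
have aeQ : {ae mu, forall s, forall n : nat,
    if unpickle n is Some r then
      has_slope (primitive F (ratr (r : rat))) s
        (\int[mu]_(u in `]-oo, ratr r]) F (u, s))
    else True}.
  apply: ae_foralln => n; case: (unpickle n) => [r|]; last exact: aeW.
  exact: primitive_slope_row.
have := ae_integrable_slice iF; move: aeQ; apply: filterS2.
  exact: (ae_filter_ringOfSetsType mu).
move=> s sQ intF t.
apply: (@monotone_slopes
  (fun t h => h^-1 * (primitive F t (h + s) - primitive F t s))
  (fun t => \int[mu]_(u in `]-oo, t]) F (u, s))).
- by move=> h h0; exact: le_primitive_quotient.
- by move=> r; have := sQ (pickle r); rewrite pickleK.
- exact: continuous_integralNy.
Qed.

Lemma ae_slope_primitive F : leb2.-integrable setT (EFin \o F) ->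
  {ae mu, forall s, forall t, has_slope (primitive F t) s
                      (\int[mu]_(u in `]-oo, t]) F (u, s))}.
Proof.
move=> iF.
have iFp : leb2.-integrable setT (EFin \o F^\+%R) by exact: integrable_funrpos.
have iFn : leb2.-integrable setT (EFin \o F^\-%R) by exact: integrable_funrneg.
have FE : F = (F^\+ \- F^\-)%R.
  by rewrite -[LHS]funrposBneg.
have := ge0_ae_slope_primitive (funrpos_ge0 F) iFp.
have := ge0_ae_slope_primitive (funrneg_ge0 F) iFn.
have i12 : {ae mu, forall v, mu.-integrable setT (fun u => (F^\+%R (u, v))%:E) /\
                             mu.-integrable setT (fun u => (F^\-%R (u, v))%:E)}.
  move: (ae_integrable_slice iFp) (ae_integrable_slice iFn).
  exact: filterS2.
move: i12; apply: filterS3 => //.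
move=> s [i1 i2] n p t.
have -> : primitive F t = (primitive F^\+%R t \- primitive F^\-%R t).
  apply/funext => y /=; rewrite {1}FE /primitive RintegralB//;
    [exact: measurable_box|exact: integrable_box..].
have -> : \int[mu]_(u in `]-oo, t]) F (u, s) =
    \int[mu]_(u in `]-oo, t]) F^\+%R (u, s)
    - \int[mu]_(u in `]-oo, t]) F^\-%R (u, s).
  rewrite -RintegralB//; [|exact: integrableS i1|exact: integrableS i2].
  by apply: eq_Rintegral => u _; rewrite {1}FE.
exact: has_slopeB.
Qed.

End differentiation.

(** * The mixed derivative of an absolutely continuous function *)

Section density.
Context {R : realType}.
Local Notation mu := (@lebesgue_measure R).
Local Notation R2 := (measurableTypeR R * measurableTypeR R)%type.
Variables a b c d : R.
Local Notation Q := (rect a b c d).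

Lemma measurable_rect :
  @measurable _ [the measurableType _ of R2] Q.
Proof. exact: (measurable_box `[a, b] `[c, d]). Qed.


(** Absolute continuity with the primitives started at -oo and all densities
    extended by zero to the whole line and plane. *)
Definition has_density (G : R * R -> R) (g : R2 -> R) : Prop :=
  leb2.-integrable setT (EFin \o g) /\
  exists alpha beta : R -> R,
    [/\ mu.-integrable setT (EFin \o alpha),
        mu.-integrable setT (EFin \o beta) &
        forall t s, Q (t, s) ->
          G (t, s) = G (a, c) + \int[mu]_(u in `]-oo, t]) alpha u
                     + \int[mu]_(v in `]-oo, s]) beta v + primitive g t s].

Lemma Rintegral_patch_itv (f : R -> R) (x y t : R) : x <= t <= y ->
  \int[mu]_(u in `[x, t]) f u = \int[mu]_(u in `]-oo, t]) (f \_ `[x, y]) u.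
Proof.
move=> /andP[xt ty]; rewrite [LHS]Rintegral_mkcond [RHS]Rintegral_mkcond.
apply: eq_Rintegral => u _; rewrite !patchE.
rewrite !mem_setE !in_itv/=.
by case: (leP u t) => ut; rewrite ?andbF// andbT (le_trans ut ty) andbT.
Qed.

Lemma abs_cont_density G : abs_cont a b c d G ->
  exists2 g, has_density G g & forall z, ~ Q z -> g z = 0.
Proof.
move=> [al [be [ga [ial ibe iga GE]]]].
exists (ga \_ Q); last by move=> z Qz; rewrite patchE memNset.
have ig : leb2.-integrable setT (EFin \o (ga \_ Q)).
  rewrite -restrict_EFin.
  exact: (integrable_mkcond (mu := leb2) (EFin \o ga) measurable_rect).1 iga.
split=> //; exists (al \_ `[a, b]), (be \_ `[c, d]); split.
- rewrite -restrict_EFin.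
  exact: (integrable_mkcond (mu := mu) (EFin \o al) (measurable_itv _)).1 ial.
- rewrite -restrict_EFin.
  exact: (integrable_mkcond (mu := mu) (EFin \o be) (measurable_itv _)).1 ibe.
move=> t s Qts; rewrite GE//; move: (Qts) => [/= + +].
rewrite !in_itv/= => tab scd.
rewrite (Rintegral_patch_itv _ tab) (Rintegral_patch_itv _ scd).
rewrite primitive_iterated// (Rintegral_patch_itv _ scd).
congr (_ + _ + _ + _); apply: eq_Rintegral => v _.
rewrite patchE; case: ifPn => vcd.
  rewrite (Rintegral_patch_itv _ tab); apply: eq_Rintegral => u _.
  by rewrite !patchE in_setX/= vcd andbT.
rewrite (@eq_Rintegral _ _ _ _ _ (cst 0)); first by rewrite /Rintegral integral0.
by move=> u _; rewrite patchE in_setX/= (negbTE vcd) andbF.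
Qed.

(** At a point whose neighbours in direction v lie in Q, restricting the
    increments to those staying in Q does not change the limit, and the
    restricted filter is proper, so that the limit is unique. *)
Lemma pderiv1_slope (v : var) (f : R * R -> R) (Phi : R -> R) z (x e l : R) :
  0 < e -> (forall h, `|h| < e -> Q (h *: var_dir v + z)) ->
  (forall h, Q (h *: var_dir v + z) -> f (h *: var_dir v + z) = Phi (h + x)) ->
  has_slope Phi x l -> pderiv1 Q v f z = l.
Proof.
move=> e0 Qz fPhi sl; rewrite /pderiv1; set A := [set h | _].
have nA : 0^' A by exists e => //= h; rewrite /ball_/= sub0r normrN => /Qz.
have PF : ProperFilter (within A 0^').
  split; last exact: within_filter.
  rewrite /within/= => A0.
  have /= := (@filter_ex _ (0^' : set_system R) _ _ (filterI nA A0)).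
  by move=> [h [Ah /(_ Ah)]].
apply: cvg_lim => //.
apply: cvg_trans (cvg_trans (cvg_app _ (@cvg_within _ _ _ A)) sl).
have fz : f z = Phi x.
  have := Qz 0; rewrite normr0 => /(_ e0) /fPhi.
  by rewrite scale0r !add0r.
apply: near_eq_cvg; near=> h.
have Ah : A h by near: h; exact: withinT.
by rewrite fz fPhi.
Unshelve. all: by end_near. Qed.

Lemma pderiv1_slope_s (f : R * R -> R) (Phi : R -> R) (t s l : R) :
  a <= t <= b -> c < s < d -> has_slope Phi s l ->
  (forall y, c <= y <= d -> f (t, y) = Phi y) ->
  pderiv1 Q Vs f (t, s) = l.
Proof.
move=> tab /andP[cs sd] sl fPhi.
have dirE (h : R) : h *: var_dir Vs + (t, s) = (t, h + s).
  by congr pair; rewrite /= ?scaler0 ?add0r// [h *: _]mulr1.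
apply: (@pderiv1_slope _ _ Phi _ s (Num.min (s - c) (d - s))) => //.
- by rewrite lt_min !subr_gt0 cs.
- move=> h; rewrite dirE lt_min !ltr_norml => h1.
  by split; rewrite /= in_itv//=; lra.
- by move=> h; rewrite dirE => -[_]; rewrite /= in_itv/= => /fPhi.
Qed.

Lemma pderiv1_slope_t (f : R * R -> R) (Phi : R -> R) (t s l : R) :
  a < t < b -> c <= s <= d -> has_slope Phi t l ->
  (forall y, a <= y <= b -> f (y, s) = Phi y) ->
  pderiv1 Q Vt f (t, s) = l.
Proof.
move=> /andP[at_ tb] scd sl fPhi.
have dirE (h : R) : h *: var_dir Vt + (t, s) = (h + t, s).
  by congr pair; rewrite /= ?scaler0 ?add0r// [h *: _]mulr1.
apply: (@pderiv1_slope _ _ Phi _ t (Num.min (t - a) (b - t))) => //.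
- by rewrite lt_min !subr_gt0 at_.
- move=> h; rewrite dirE lt_min !ltr_norml => h1.
  by split; rewrite /= in_itv//=; lra.
- by move=> h; rewrite dirE => -[+ _]; rewrite /= in_itv/= => /fPhi.
Qed.

(** For almost every s the inner derivative exists at every t of [a, b] and is an
    indefinite integral in t plus a constant; this can then be differentiated at
    almost every t. Existence at every t is essential: the outer difference
    quotient at t samples the inner derivative at all nearby points. *)
Lemma ae_mixed_derivative (G : R * R -> R) g : has_density G g ->
  {ae mu, forall s, {ae mu, forall t, a < t < b -> c < s < d ->
     pderiv Q [:: Vt; Vs] G (t, s) = g (t, s)}}.
Proof.
move=> [ig [al [be [ial ibe GE]]]].
have := ae_integrable_slice ig.
have := ae_slope_integral ibe.
have := ae_slope_primitive ig.
apply: filterS3; first exact: (ae_filter_ringOfSetsType mu).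
move=> s sg sb islice.
have := ae_slope_integral islice; apply: filterS.
  exact: (ae_filter_ringOfSetsType mu).
move=> t st tab scd /=.
apply: (pderiv1_slope_t tab _ (l := g (t, s))).
- by move/andP : scd => [/ltW-> /ltW].
- have := has_slopeD (f := cst (be s)) (x := t) (l := 0).
  move=> /(_ _ _ _ st); rewrite add0r; apply.
  rewrite /has_slope; under eq_fun do rewrite subrr mulr0.
  exact: cvg_cst.
move=> y yab /=.
apply: (pderiv1_slope_s yab scd (Phi := fun v => G (a, c) +
  \int[mu]_(u in `]-oo, y]) al u + \int[mu]_(w in `]-oo, v]) be w
  + primitive g y v)).
  apply: has_slopeD => //.
  rewrite -[be s]add0r; apply: has_slopeD => //.
  rewrite /has_slope; under eq_fun do rewrite subrr mulr0.
  exact: cvg_cst.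
by move=> v vcd; apply: GE; split; rewrite /= in_itv.
Qed.

End density.

Section ae_product.
Context {R : realType}.
Local Notation mu := (@lebesgue_measure R).
Local Notation R2 := (measurableTypeR R * measurableTypeR R)%type.

(** Both directions are used: to cut a planar null set into null slices, and to
    reassemble null slices into a planar null set. *)
Lemma leb2_null_slices (N : set R2) : measurable N ->
  leb2 N = 0%E <-> {ae mu, forall s, mu (ysection N s) = 0%E}.
Proof.
move=> mN.
have mi : measurable_fun setT (EFin \o \1_N : R2 -> \bar R).
  by apply/measurable_EFinP; exact: measurable_indic.
have i0 z : (0 <= (EFin \o \1_N : R2 -> \bar R) z)%E by rewrite lee_fin.
have -> : leb2 N = (\int[mu]_s mu (ysection N s))%E.
  rewrite -[N in LHS]setIT -integral_indic// /leb2.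
  rewrite (fubini_tonelli2 (EFin \o \1_N) mi i0).
  by rewrite (indic_fubini_tonelli_GE _ mN).
have my := measurable_fun_ysection mu mN.
have -> : (\int[mu]_s mu (ysection N s) = \int[mu]_s `|mu (ysection N s)|)%E.
  by apply: eq_integral => s _; rewrite gee0_abs.
have [H1 H2] := ae_eq_integral_abs mu measurableT my.
split.
  by move=> /H1; apply: filterS => s /(_ I).
move=> H; apply: H2; by apply: filterS H => s E _; exact: E.
Qed.

Lemma ae_neq_point (x : R) : {ae mu, forall y, y != x}.
Proof.
exists [set x]; split => //; first exact: lebesgue_measure_set1.
by move=> y /= /negP; rewrite negbK => /eqP.
Qed.

(** Passing from slices to the plane requires a measurable exceptional set, while
    the set where the mixed derivative differs from g need not be a Borel set. The
    Borel function h equal almost everywhere to the derivative repairs this: the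
    set where h and g differ is Borel, and it has null slices. *)
Lemma ae_mixed_derivative_density (a b c d : R) (G : R * R -> R) (g : R2 -> R)
    (h : R * R -> R) :
  has_density a b c d G g -> (forall z, ~ rect a b c d z -> g z = 0) ->
  measurable_fun (rect a b c d) h ->
  pderiv (rect a b c d) [:: Vt; Vs] G = h %[ae leb2 in rect a b c d] ->
  {ae leb2, forall z,
    (pderiv (rect a b c d) [:: Vt; Vs] G \_ (rect a b c d)) z = g z}.
Proof.
set Q := rect a b c d; set D := pderiv Q _ G => dG g0 mh [N [mN N0 subN]].
have mQ := measurable_rect a b c d.
have mg : measurable_fun setT g.
  by apply/measurable_EFinP; exact: measurable_int dG.1.
have mhQ : measurable_fun (setT : set R2) (h \_ Q : R2 -> measurableTypeR R).
  exact: (measurable_restrictT _ mQ).1 mh.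
pose B : set R2 := [set z | (h \_ Q) z != g z].
have mB : measurable B.
  rewrite (_ : B = ((h \_ Q) \- g) @^-1` (~` [set 0])).
    rewrite -[X in measurable X]setTI.
    apply: (measurable_funB mhQ mg) => //; apply: measurableC.
    exact: measurable_set1.
  apply/seteqP; split => z; rewrite /B/= => /eqP.
    by move=> hg /eqP; rewrite subr_eq0 => /eqP.
  by rewrite subr_eq0.
have mE z : Q z -> (h \_ Q) z = h z by move=> Qz; rewrite patchE mem_set.
suff B0 : leb2 B = 0%E.
  exists (N `|` B); split; [exact: measurableU|by rewrite measureU0|].
  move=> z /= Dgz; have [Nz|Nz] := pselect (N z); [by left|right].
  have [Qz|Qz] := pselect (Q z); last first.
    by exfalso; apply: Dgz; rewrite patchE memNset// g0.
  apply/negP => /eqP hgz; apply: Dgz; rewrite -hgz mE// patchE mem_set//.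
  by apply: contrapT => Dhz; apply: Nz; apply: subN => /(_ Qz).
apply/leb2_null_slices => //.
have aeN := (leb2_null_slices mN).1 N0.
have aeD := ae_mixed_derivative dG.
have aecd : {ae mu, forall s, s != c /\ s != d}.
  move: (ae_neq_point c) (ae_neq_point d); apply: filterS2.
    exact: (ae_filter_ringOfSetsType mu).
  by move=> r r1 r2; split.
move: aecd aeD aeN; apply: filterS3; first exact: (ae_filter_ringOfSetsType mu).
move=> s [sc sd] aeD Ns0.
have mBs : measurable (ysection B s) by exact: measurable_ysection.
have mNs : measurable (ysection N s) by exact: measurable_ysection.
apply: (measure_negligible mBs).
have aeNs : {ae mu, forall t, ~ N (t, s)}.
  exists (ysection N s); split => // t /= /contrapT Nts.
  exact: mem_set.
have aeab : {ae mu, forall s, s != a /\ s != b}.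
  move: (ae_neq_point a) (ae_neq_point b); apply: filterS2.
    exact: (ae_filter_ringOfSetsType mu).
  by move=> r r1 r2; split.
have : {ae mu, forall t, ~ B (t, s)}.
  move: aeab aeD aeNs; apply: filterS3; first exact: (ae_filter_ringOfSetsType mu).
  move=> t [ta tb] Dts Nts; rewrite /B/= => /negP; apply; apply/eqP.
  have [Qz|Qz] := pselect (Q (t, s)); last by rewrite patchE memNset// g0.
  rewrite mE//; have <- : D (t, s) = h (t, s).
    by apply: contrapT => Dhz; apply: Nts; apply: subN => /(_ Qz).
  move: Qz => [/=]; rewrite !in_itv/= => /andP[at_ tb'] /andP[cs sd'].
  by apply: Dts; rewrite !lt_neqAle ?at_ ?tb' ?cs ?sd' ?andbT ?tb ?sd//=
    eq_sym ?ta ?sc.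
apply: negligibleS => t; rewrite ysectionE /=.
by move=> Bts; rewrite /= notK; exact: Bts.
Qed.

End ae_product.

(** * Norms of functions known almost everywhere *)

Section ae_norm.
Context d (T : measurableType d) (R : realType).
Variable mu : {measure set T -> \bar R}.
Local Open Scope ereal_scope.

(** No measurability of k is available, since k will be a limit of difference
    quotients; off a Borel null set, k dominates the measurable function f, and
    the supremum over simple functions below k is monotone in k. *)
Lemma ge0_ae_le_integral_nonmeasurable (f k : T -> \bar R) :
  measurable_fun setT f -> (forall x, 0 <= f x) -> (forall x, 0 <= k x) ->
  {ae mu, forall x, k x = f x} ->
  \int[mu]_x f x <= \int[mu]_x k x.
Proof.
move=> mf f0 k0 [N [mN N0 subN]].
rewrite (ge0_negligible_integral mN)// setTD integral_mkcond.
have fk x : (f \_ (~` N)) x <= k x.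
  rewrite patchE; case: ifPn => [|_]; last exact: k0.
  rewrite inE /= => Nx; have [->//|kf] := pselect (k x = f x).
  by exfalso; apply: Nx; exact: subN.
rewrite !ge0_integralTE//; last exact: erestrict_ge0.
apply: le_ereal_sup => _ [h hf <-]; exists h => //.
by move=> x; exact: le_trans (hf x) (fk x).
Qed.

Lemma ae_eq_le_Lnorm (p : R) (u g : T -> R) : (0 < p)%R ->
  measurable_fun setT g -> {ae mu, forall x, u x = g x} ->
  'N[mu]_p%:E[EFin \o g] <= 'N[mu]_p%:E[EFin \o u].
Proof.
move=> p0 mg ug; rewrite unlock /Lnorm.
apply: gt0_ler_poweR.
- by rewrite invr_ge0 ltW.
- by rewrite in_itv/= leey andbT integral_ge0// => x _; exact: poweR_ge0.
- by rewrite in_itv/= leey andbT integral_ge0// => x _; exact: poweR_ge0.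
apply: ge0_ae_le_integral_nonmeasurable => //.
- have mag : measurable_fun setT (abse \o (EFin \o g)).
    by apply: measurableT_comp => //; exact/measurable_EFinP.
  exact: (measurableT_comp (measurable_poweR p) mag).
- by move=> x; exact: poweR_ge0.
- by move=> x; exact: poweR_ge0.
by apply: filterS ug => x /= ->.
Qed.

End ae_norm.

(** * Partitions and uniqueness of the Stieltjes integral *)

Section partitions.
Context {R : realType}.
Implicit Types (a b c d : R) (xs ys : seq R).

Lemma node_le a b xs i : itv_partition a b xs -> (i < size xs)%N ->
  node a xs i <= node a xs i.+1.
Proof.
move=> [/pathP xsP _] ixs; rewrite /node /=.
exact/ltW/(xsP a).
Qed.

Lemma node_in a b xs i : itv_partition a b xs -> (i <= size xs)%N ->
  a <= node a xs i <= b.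
Proof.
move=> abxs ixs; rewrite /node (set_nth_default b)//.
by rewrite itv_partition_nth_ge// itv_partition_nth_le.
Qed.

Lemma node_size a b xs : itv_partition a b xs -> node a xs (size xs) = b.
Proof. exact: itv_partition_nth_size. Qed.

(** Steps of length delta / 2 keep the mesh strictly below delta. *)
Lemma exists_fine_partition a b delta : a < b -> 0 < delta ->
  exists2 xs, itv_partition a b xs & mesh_lt a xs delta.
Proof.
move=> ab d0.
have [n bn] : exists n : nat, b <= a + n%:R * (delta / 2).
  have d20 : 0 < delta / 2 by rewrite divr_gt0.
  exists (Num.bound ((b - a) / (delta / 2))).
  rewrite -lerBlDl -ler_pdivrMr// ltW// archi_boundP//.
  by rewrite divr_ge0 ?subr_ge0 ?ltW.
elim: n a ab bn => [a ab|n IH a ab bn]; first by rewrite mul0r addr0 leNgt ab.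
have [bd|db] := leP b (a + delta / 2).
  exists [:: b]; first exact: itv_partition1.
  by case=> [|i]//= _; rewrite /node/=; lra.
have [|xs xsP mxs] := IH (a + delta / 2) db.
  by move: bn; rewrite -natr1 mulrDl mul1r; lra.
exists (a + delta / 2 :: xs).
  case: xsP => p l; split => //=.
  by rewrite p andbT; lra.
case=> [_|i]/=; first by rewrite /node/=; lra.
move=> ixs; have := mxs i ixs; rewrite /node.
by rewrite !(set_nth_default a)//= ltnW.
Qed.

(** The mixed differences telescope in both directions. *)
Lemma sum_Delta11 (P : R * R -> R) a b c d xs ys :
  itv_partition a b xs -> itv_partition c d ys ->
  \sum_(i < size xs) \sum_(j < size ys) Delta11 a c P xs ys i j =
  P (a, c) - P (a, d) - P (b, c) + P (b, d).
Proof.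
move=> abxs cdys.
pose u i j := P (node a xs i, node c ys j).
transitivity (\sum_(0 <= i < size xs)
    ((u i.+1 (size ys) - u i.+1 0%N) - (u i (size ys) - u i 0%N))).
  rewrite big_mkord; apply: eq_bigr => i _.
  rewrite -(telescope_sumr (fun j => u i.+1 j))//.
  rewrite -(telescope_sumr (fun j => u i j))//.
  rewrite -sumrB big_mkord; apply: eq_bigr => j _.
  by rewrite /Delta11 /u; ring.
rewrite (telescope_sumr (fun i => u i (size ys) - u i 0%N))//.
by rewrite /u (node_size abxs) (node_size cdys) /node/=; ring.
Qed.

(** The lower left corners of a common fine partition give one sum close to both
    values. *)
Lemma is_RSint_unique a b c d (h g : R * R -> R) I J : a < b -> c < d ->
  is_RSint a b c d h g I -> is_RSint a b c d h g J -> I = J.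
Proof.
move=> ab cd hI hJ; apply/eqP; rewrite -subr_eq0 -normr_le0.
apply/ler_addgt0Pl => e e0; rewrite addr0.
have e20 : 0 < e / 2 by rewrite divr_gt0.
have [d1 d10 H1] := hI _ e20; have [d2 d20 H2] := hJ _ e20.
have dm : 0 < Num.min d1 d2 by rewrite lt_min d10.
have [xs xsP mx] := exists_fine_partition ab dm.
have [ys ysP my] := exists_fine_partition cd dm.
pose xi i j := (node a xs i, node c ys j).
have tg : tags a c xs ys xi.
  move=> i j ix jy; split => /=; rewrite in_itv/= lexx/=.
    exact: node_le xsP ix.
  exact: node_le ysP jy.
have {}mx1 : mesh_lt a xs d1 by move=> i /mx; rewrite lt_min => /andP[].
have {}mx2 : mesh_lt a xs d2 by move=> i /mx; rewrite lt_min => /andP[].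
have {}my1 : mesh_lt c ys d1 by move=> i /my; rewrite lt_min => /andP[].
have {}my2 : mesh_lt c ys d2 by move=> i /my; rewrite lt_min => /andP[].
have := H1 xs ys xi xsP ysP mx1 my1 tg.
have := H2 xs ys xi xsP ysP mx2 my2 tg.
by rewrite !ltr_norml ler_norml; lra.
Qed.

Lemma RSintE a b c d (h g : R * R -> R) I : a < b -> c < d ->
  is_RSint a b c d h g I -> RSint a b c d h g = I.
Proof.
move=> ab cd hI; apply: (is_RSint_unique ab cd _ hI).
by rewrite /RSint; case: xgetP => [x ->//|/(_ I)].
Qed.

End partitions.

(** * Reduction of the Stieltjes integral to a Lebesgue integral *)

Section stieltjes.
Context {R : realType}.
Local Notation mu := (@lebesgue_measure R).
Local Notation R2 := (measurableTypeR R * measurableTypeR R)%type.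
Variables a b c d : R.
Hypotheses (ab : a < b) (cd : c < d).
Local Notation Q := (rect a b c d).

Definition cell (x x' y y' : R) : set R2 := `]x, x'] `*` `]y, y'].

Lemma sum_cells (F : R2 -> R) xs ys : leb2.-integrable setT (EFin \o F) ->
  itv_partition a b xs -> itv_partition c d ys ->
  \sum_(i < size xs) \sum_(j < size ys)
    \int[leb2]_(z in cell (node a xs i) (node a xs i.+1)
                          (node c ys j) (node c ys j.+1)) F z
  = \int[leb2]_(z in cell a b c d) F z.
Proof.
move=> iF xsP ysP.
rewrite -(primitive_cell iF (ltW ab) (ltW cd)).
rewrite -(sum_Delta11 (fun z => primitive F z.1 z.2) xsP ysP).
apply: eq_bigr => i _; apply: eq_bigr => j _.
rewrite -(primitive_cell iF)//; [exact: node_le xsP _|exact: node_le ysP _].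
Qed.

(** The terms of G depending on one variable only cancel in a mixed difference. *)
Lemma Delta11_density (G : R * R -> R) g xs ys i j :
  has_density a b c d G g -> itv_partition a b xs -> itv_partition c d ys ->
  (i < size xs)%N -> (j < size ys)%N ->
  Delta11 a c G xs ys i j =
  \int[leb2]_(z in cell (node a xs i) (node a xs i.+1)
                        (node c ys j) (node c ys j.+1)) g z.
Proof.
move=> [ig [al [be [_ _ GE]]]] xsP ysP ix jy.
rewrite -(primitive_cell ig (node_le xsP ix) (node_le ysP jy)) /Delta11.
have nx k : (k <= size xs)%N -> `[a, b]%classic (node a xs k).
  by move=> kx; rewrite /= in_itv/=; exact: node_in xsP kx.
have ny k : (k <= size ys)%N -> `[c, d]%classic (node c ys k).
  by move=> ky; rewrite /= in_itv/=; exact: node_in ysP ky.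
have Gn k l : (k <= size xs)%N -> (l <= size ys)%N ->
  G (node a xs k, node c ys l) = G (a, c)
     + \int[mu]_(u in `]-oo, (node a xs k)]) al u
     + \int[mu]_(v in `]-oo, (node c ys l)]) be v
     + primitive g (node a xs k) (node c ys l).
  by move=> kx ly; apply: GE; split; [exact: nx|exact: ny].
by rewrite !Gn// 1?ltnW//; ring.
Qed.

(** Uniform continuity on Q in the sup distance, written for the cells of a
    grid. *)
Definition grid_continuous (h : R * R -> R) : Prop :=
  forall e, 0 < e -> exists2 delta, 0 < delta & forall z w, Q z -> Q w ->
    `|z.1 - w.1| < delta -> `|z.2 - w.2| < delta -> `|h z - h w| <= e.

(** On each cell, freezing h at the tag changes the integral of h g by at most the
    oscillation of h times the integral of |g|; the errors add up to the
    oscillation times the integral of |g| over Q. *)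
Lemma is_RSint_density (h G : R * R -> R) g :
  has_density a b c d G g -> grid_continuous h ->
  leb2.-integrable setT (fun z => (h z * g z)%:E) ->
  is_RSint a b c d h G (\int[leb2]_(z in cell a b c d) (h z * g z)).
Proof.
move=> dG hc ihg e e0; have ig := dG.1.
have iabs : leb2.-integrable setT (EFin \o (fun z => `|g z|)).
  exact: integrable_norm.
pose M := \int[leb2]_(z in cell a b c d) `|g z|.
have M0 : 0 <= M by apply: Rintegral_ge0.
have [delta delta0 hdelta] := hc (e / (M + 1)) ltac:(rewrite divr_gt0//; lra).
exists delta => // xs ys xi xsP ysP mx my tg.
set eps := e / (M + 1) in hdelta.
have eps0 : 0 < eps by rewrite divr_gt0//; lra.
apply: (@le_lt_trans _ _ (eps * M)); last first.
  by rewrite /eps mulrAC ltr_pdivrMr; [nra|lra].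
rewrite -(sum_cells ihg xsP ysP) /M -(sum_cells iabs xsP ysP).
rewrite /RS_sum -sumrB mulr_sumr (le_trans (ler_norm_sum _ _ _))//.
apply: ler_sum => i _.
rewrite -sumrB mulr_sumr (le_trans (ler_norm_sum _ _ _))//.
apply: ler_sum => j _.
have ix := ltn_ord i; have jy := ltn_ord j.
rewrite (Delta11_density dG xsP ysP ix jy).
set C := cell _ _ _ _.
have mC : measurable C by exact: measurable_box.
have iCF F : leb2.-integrable setT (EFin \o F) -> leb2.-integrable C (EFin \o F).
  by move=> iF; exact: integrable_box.
have ig' := iCF _ ig; have ihg' := iCF _ ihg; have iabs' := iCF _ iabs.
have izl k F : leb2.-integrable C (EFin \o F) ->
    leb2.-integrable C (EFin \o (fun z => k * F z)).
  move=> iF; have -> : EFin \o (fun z => k * F z) =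
      (fun z => k%:E * (EFin \o F) z)%E.
    by apply/funext => z; rewrite /= EFinM.
  exact: integrableZl.
have iB : leb2.-integrable C (EFin \o (fun z => h (xi i j) * g z - h z * g z)).
  exact: (integrableB mC (izl _ _ ig') ihg').
rewrite -RintegralZl// -RintegralZl// -RintegralB//; last exact: izl.
rewrite (le_trans (le_normr_Rintegral _ _))//.
apply: le_Rintegral => //.
- exact: integrable_norm.
- exact: izl.
move=> z Cz; rewrite -mulrBl normrM ler_wpM2r//.
have [] := tg i j ix jy; rewrite /= !in_itv/= => x1 x2.
case: Cz => /=; rewrite !in_itv/= => z1 z2.
have /andP[n1 _] := node_in xsP (ltnW ix); have /andP[_ n2] := node_in xsP ix.
have /andP[n3 _] := node_in ysP (ltnW jy); have /andP[_ n4] := node_in ysP jy.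
have m1 := mx _ ix; have m2 := my _ jy.
apply: hdelta.
- by split; rewrite /= in_itv/=; lra.
- by split; rewrite /= in_itv/=; lra.
- by rewrite ltr_norml; lra.
- by rewrite ltr_norml; lra.
Qed.

End stieltjes.

(** * The kernel as a product of one-variable kernels *)

Section kernel.
Context {R : realType}.
Implicit Types (a b c d x y t s : R).

(** A factor of S_n written with truncated powers: a polynomial in Lipschitz
    functions is Lipschitz across the break at x, with no gluing. The two terms
    do not interfere because 0 ^+ n = 0 for n > 0. *)
Definition kernel1 (n : nat) (a b x t : R) : R :=
  (b - x) * Num.max (x - t) 0 ^+ n
  + (-1) ^+ n.+1 * (x - a) * Num.max (t - x) 0 ^+ n.

Lemma kernel1_left n a b x t : (0 < n)%N -> t <= x ->
  kernel1 n a b x t = (b - x) * (x - t) ^+ n.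
Proof.
move=> n0 tx; rewrite /kernel1.
have -> : Num.max (x - t) 0 = x - t by apply/max_idPl; rewrite subr_ge0.
have -> : Num.max (t - x) 0 = 0 by apply/max_idPr; rewrite subr_le0.
by rewrite expr0n gtn_eqF// mulr0 addr0.
Qed.

Lemma kernel1_right n a b x t : (0 < n)%N -> x <= t ->
  kernel1 n a b x t = (-1) ^+ n.+1 * (x - a) * (t - x) ^+ n.
Proof.
move=> n0 tx; rewrite /kernel1.
have -> : Num.max (x - t) 0 = 0 by apply/max_idPr; rewrite subr_le0.
have -> : Num.max (t - x) 0 = t - x by apply/max_idPl; rewrite subr_ge0.
by rewrite expr0n gtn_eqF// mulr0 add0r.
Qed.

Lemma Sn_kernel1 a b c d n x y t s : (0 < n)%N ->
  Sn a b c d n x y (t, s) = (n`!%:R)^-1 * (kernel1 n a b x t * kernel1 n c d y s).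
Proof.
move=> n0; rewrite /Sn; congr (_ * _).
have E : (-1) ^+ n.+1 * (-1) ^+ n.+1 = 1 :> R.
  by rewrite -exprD addnn -mul2n exprM sqrrN !expr1n.
case: (leP t x) => tx;
  [rewrite (kernel1_left _ _ n0 tx)|rewrite (kernel1_right _ _ n0 (ltW tx))];
  (case: (leP s y) => sy;
    [rewrite (kernel1_left _ _ n0 sy)|rewrite (kernel1_right _ _ n0 (ltW sy))]).
- by ring.
- by ring.
- by ring.
- rewrite -[LHS]mul1r -[X in X * _ = _]E.
  by move: ((-1) ^+ n.+1) => e; ring.
Qed.

Lemma expr_lipschitz (M : R) n : 0 <= M -> exists2 L, 0 <= L &
  forall u v, 0 <= u <= M -> 0 <= v <= M -> `|u ^+ n - v ^+ n| <= L * `|u - v|.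
Proof.
move=> M0; elim: n => [|n [L L0 IH]].
  by exists 0 => // u v _ _; rewrite !expr0 subrr normr0 mul0r.
exists (M * L + M ^+ n); first by rewrite addr_ge0 ?mulr_ge0 ?exprn_ge0.
move=> u v uM vM; rewrite !exprS.
have -> : u * u ^+ n - v * v ^+ n = u * (u ^+ n - v ^+ n) + (u - v) * v ^+ n.
  by ring.
have /andP[u0 uM'] := uM; have /andP[v0 vM'] := vM.
apply: le_trans (ler_normD _ _) _; rewrite [leRHS]mulrDl !normrM; apply: lerD.
  by rewrite -mulrA ler_pM// ?IH// ger0_norm.
rewrite mulrC ler_wpM2r// ger0_norm ?exprn_ge0//.
by rewrite lerXn2r ?nnegrE// (le_trans v0).
Qed.

Lemma kernel1_lipschitz n a b x : a <= x <= b -> exists2 L, 0 <= L &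
  forall t t', a <= t <= b -> a <= t' <= b ->
    `|kernel1 n a b x t - kernel1 n a b x t'| <= L * `|t - t'|.
Proof.
move=> /andP[ax xb].
have ba0 : 0 <= b - a by lra.
have [L L0 HL] := expr_lipschitz n ba0.
exists (`|b - x| * L + `|(-1) ^+ n.+1 * (x - a)| * L).
  by rewrite addr_ge0 ?mulr_ge0.
move=> t t' tab t'ab; rewrite /kernel1.
have -> : forall p q r s u v : R,
    p * q + r * s - (p * u + r * v) = p * (q - u) + r * (s - v).
  by move=> *; ring.
have mx (u : R) : u <= b - a -> 0 <= Num.max u 0 <= b - a.
  by move=> ub; rewrite le_max lexx orbT ge_max ub ba0.
have mxl (u v : R) : `|Num.max u 0 - Num.max v 0| <= `|u - v|.
  by case: (leP u 0) => u0; case: (leP v 0) => v0; rewrite ler_norml;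
     (have [uv|uv] := leP 0 (u - v);
       [rewrite (ger0_norm uv)|rewrite (ltr0_norm uv)]; lra).
apply: le_trans (ler_normD _ _) _; rewrite [leRHS]mulrDl; apply: lerD;
  rewrite normrM -mulrA ler_wpM2l//.
- apply: le_trans (HL _ _ (mx _ _) (mx _ _)) _; [lra..|].
  by apply: ler_wpM2l => //; apply: le_trans (mxl _ _) _;
     rewrite (_ : x - t - (x - t') = t' - t) 1?distrC//; ring.
- apply: le_trans (HL _ _ (mx _ _) (mx _ _)) _; [lra..|].
  by apply: ler_wpM2l => //; apply: le_trans (mxl _ _) _;
     rewrite (_ : t - x - (t' - x) = t - t')//; ring.
Qed.

Lemma kernel1_bounded n a b x : a <= x <= b -> exists2 K, 0 <= K &
  forall t, a <= t <= b -> `|kernel1 n a b x t| <= K.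
Proof.
move=> xab; have [L L0 HL] := kernel1_lipschitz n xab.
exists (`|kernel1 n a b x a| + L * (b - a)).
  by rewrite addr_ge0 ?mulr_ge0//; lra.
move=> t tab; rewrite -[kernel1 n a b x t](subrK (kernel1 n a b x a)) addrC.
apply: le_trans (ler_normD _ _) _; rewrite lerD2l.
apply: le_trans (HL _ _ tab _) _; first lra.
by rewrite ler_wpM2l// ger0_norm; lra.
Qed.

Lemma Sn_grid_continuous a b c d n x y : (0 < n)%N ->
  a <= x <= b -> c <= y <= d ->
  grid_continuous a b c d (Sn a b c d n x y).
Proof.
move=> n0 xab ycd e e0.
have [L1 L10 HL1] := kernel1_lipschitz n xab.
have [L2 L20 HL2] := kernel1_lipschitz n ycd.
have [K1 K10 HK1] := kernel1_bounded n xab.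
have [K2 K20 HK2] := kernel1_bounded n ycd.
set k := (n`!%:R)^-1 : R; have k0 : 0 <= k by rewrite invr_ge0.
pose C := k * (K1 * L2 + K2 * L1).
have C0 : 0 <= C by rewrite mulr_ge0// addr_ge0 ?mulr_ge0.
exists (e / (C + 1)); first by rewrite divr_gt0//; lra.
move=> [t s] [t' s'] [tQ sQ] [t'Q s'Q] dt ds; rewrite !Sn_kernel1//.
move: tQ sQ t'Q s'Q dt ds; rewrite /= !in_itv/= => tab scd t'ab s'cd dt ds.
rewrite -mulrBr normrM (ger0_norm k0).
set u := kernel1 n a b x t; set v := kernel1 n c d y s.
set u' := kernel1 n a b x t'; set v' := kernel1 n c d y s'.
have -> : u * v - u' * v' = u * (v - v') + (u - u') * v' by ring.
set del := e / (C + 1) in dt ds.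
have del0 : 0 < del by rewrite divr_gt0//; lra.
apply: (@le_trans _ _ (C * del)); last first.
  rewrite /del mulrA ler_pdivrMr; [nra|lra].
rewrite /C -mulrA ler_wpM2l//; apply: le_trans (ler_normD _ _) _.
rewrite [leRHS]mulrDl; apply: lerD; rewrite normrM.
  rewrite -mulrA ler_pM ?HK1// (le_trans (HL2 _ _ scd s'cd))//.
  by rewrite ler_wpM2l// ltW.
rewrite mulrC -mulrA ler_pM ?HK2// (le_trans (HL1 _ _ tab t'ab))//.
by rewrite ler_wpM2l// ltW.
Qed.

Lemma measurable_kernel1 n a b x : measurable_fun setT (kernel1 n a b x).
Proof.
rewrite /kernel1.
apply: measurable_funD; apply: measurable_funM => //; apply: measurable_funX;
  apply: measurable_maxr => //; exact: measurable_funB.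
Qed.

End kernel.

(** * Moments of the kernel *)

Section powR_integrals.
Context {R : realType}.
Local Notation mu := (@lebesgue_measure R).

Lemma is_derive_powR_subr (u r t : R) : u < t ->
  is_derive t (1 : R) (fun t : R => (t - u) `^ r) (r * (t - u) `^ (r - 1)).
Proof.
move=> ut; have tu0 : 0 < t - u by rewrite subr_gt0.
rewrite -[X in is_derive _ _ _ X]mulr1.
have -> : (fun t : R => (t - u) `^ r) = (@powR R ^~ r) \o shift (- u) by [].
by apply: is_derive1_comp; [exact: is_derive1_powR|exact: is_derive_shift].
Qed.

(** At the left end point the base is 0, where only a one-sided limit is available
    because of the convention on powers of negative reals. *)
Lemma powR_subr_LRcontinuous (u v r : R) : u < v -> 0 < r ->
  derivable_oo_LRcontinuous (fun t : R => (t - u) `^ r) u v.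
Proof.
move=> uv r0; split.
- move=> t; rewrite in_itv/= => /andP[ut tv].
  by case: (is_derive_powR_subr r ut).
- rewrite subrr powR0 ?gt_eqF//; apply/cvgrPdist_lt => e e0.
  apply/nbhs_right0P; have /cvgrPdist_lt/(_ _ e0) := powR_cvg0 r0.
  apply: filterS => y; rewrite /= (_ : u + y - u = y)//; ring.
- apply: cvg_at_left_filter.
  have dv : derivable (fun t : R => (t - u) `^ r) v 1.
    by case: (is_derive_powR_subr r uv).
  by move/derivable1_diffP : dv => /differentiable_continuous.
Qed.

Lemma integral_powR_subr (u v r : R) : u <= v -> 0 < r ->
  (\int[mu]_(t in `[u, v]) ((t - u) `^ r)%:E = ((v - u) `^ (r + 1) / (r + 1))%:E)%E.
Proof.
rewrite le_eqVlt => /predU1P[<-|uv] r0.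
  by rewrite set_itv1 integral_set1 subrr powR0 ?mul0r// gt_eqF//; lra.
have r1 : 0 < r + 1 by lra.
have [d1 d2 d3] := powR_subr_LRcontinuous uv r1.
rewrite (@continuous_FTC2 _ _ (fun t : R => (r + 1)^-1 * (t - u) `^ (r + 1)))//.
- rewrite subrr powR0 ?gt_eqF// mulr0 sube0 mulrC//.
- exact/derivable_oo_LRcontinuous_within/powR_subr_LRcontinuous.
- split.
  + by move=> t /d1 dt; exact: derivableZ.
  + exact: cvgMr.
  + exact: cvgMr.
- move=> t; rewrite in_itv/= => /andP[ut tv]; rewrite derive1E.
  have D := is_deriveZ (r + 1)^-1 (is_derive_powR_subr (r + 1) ut).
  rewrite (_ : (fun _ => _) = (r + 1)^-1 \*: (fun t : R => (t - u) `^ (r + 1)))//.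
  rewrite derive_val addrK [_ *: _]mulrA mulVf ?mul1r// gt_eqF//.
Qed.

(** By reflection of the interval. *)
Lemma integral_powR_rsub (u v r : R) : u <= v -> 0 < r ->
  (\int[mu]_(t in `[u, v]) ((v - t) `^ r)%:E = ((v - u) `^ (r + 1) / (r + 1))%:E)%E.
Proof.
rewrite le_eqVlt => /predU1P[<-|uv] r0.
  by rewrite set_itv1 integral_set1 subrr powR0 ?mul0r// gt_eqF//; lra.
have uv' : - v < - u by rewrite ltrN2.
have := integral_powR_subr (ltW uv') r0.
rewrite (integration_by_substitution_oppr (G := fun t => (t - - v) `^ r) (ltW uv)).
  rewrite opprK [in RHS]addrC => <-; apply: eq_integral => t _ /=.
  by rewrite addrC.
exact/derivable_oo_LRcontinuous_within/powR_subr_LRcontinuous.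
Qed.

End powR_integrals.

Section kernel_norm.
Context {R : realType}.
Local Notation mu := (@lebesgue_measure R).
Local Notation R2 := (measurableTypeR R * measurableTypeR R)%type.
Implicit Types (a b c d x y t s p q : R).

Lemma measurable_fun_powRr (disp : measure_display)
    (T : measurableType disp) (D : set T) (f : T -> R) q :
  measurable_fun D f -> measurable_fun D (fun z => f z `^ q).
Proof. by move=> mf; exact: (measurableT_comp (measurable_powR q) mf). Qed.

(** The integral over [a, b] of the q-th power of the absolute value of the
    one-variable kernel. *)
Definition kernel1_moment (n : nat) (a b x q : R) : R :=
  ((b - x) `^ q * (x - a) `^ (n%:R * q + 1)
   + (x - a) `^ q * (b - x) `^ (n%:R * q + 1)) / (n%:R * q + 1).

Lemma kernel1_moment_ge0 n a b x q : 0 <= q -> 0 <= kernel1_moment n a b x q.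
Proof.
move=> q0; have nq : 0 <= n%:R * q + 1 by rewrite addr_ge0// mulr_ge0.
by rewrite /kernel1_moment divr_ge0// addr_ge0// mulr_ge0// powR_ge0.
Qed.

Lemma integral_kernel1_powR n a b x q : (0 < n)%N -> a <= x <= b -> 0 < q ->
  (\int[mu]_(t in `[a, b]) (`|kernel1 n a b x t| `^ q)%:E
   = (kernel1_moment n a b x q)%:E)%E.
Proof.
move=> n0 /andP[ax xb] q0.
have nq0 : 0 < n%:R * q by rewrite mulr_gt0// ltr0n.
have mk : measurable_fun setT (fun t => (`|kernel1 n a b x t| `^ q)%:E).
  apply/measurable_EFinP; apply: measurable_fun_powRr.
  by apply: measurableT_comp => //; exact: measurable_kernel1.
rewrite (@itv_bndbnd_setU _ _ _ (BRight x)) ?bnd_simp//.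
rewrite ge0_integral_setU//=; last 2 first.
- exact: (measurable_funTS mk).
- apply/disj_setPS => t /= []; rewrite !in_itv/= => /andP[_ tx] /andP[xt _].
  by move: (lt_le_trans xt tx); rewrite ltxx.
rewrite integral_itv_obnd_cbnd; last exact: (measurable_funTS mk).
have -> : (\int[mu]_(t in `[a, x]) (`|kernel1 n a b x t| `^ q)%:E =
    \int[mu]_(t in `[a, x]) (((b - x) `^ q)%:E * ((x - t) `^ (n%:R * q))%:E))%E.
  apply: eq_integral => t; rewrite inE/= in_itv/= => /andP[_ tx].
  have xt0 : 0 <= x - t by rewrite subr_ge0.
  rewrite kernel1_left// normrM !ger0_norm ?exprn_ge0// ?subr_ge0//.
  by rewrite powRM ?exprn_ge0 ?subr_ge0// -powR_mulrn// -powRrM.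
have -> : (\int[mu]_(t in `[x, b]) (`|kernel1 n a b x t| `^ q)%:E =
    \int[mu]_(t in `[x, b]) (((x - a) `^ q)%:E * ((t - x) `^ (n%:R * q))%:E))%E.
  apply: eq_integral => t; rewrite inE/= in_itv/= => /andP[xt _].
  have xt0 : 0 <= t - x by rewrite subr_ge0.
  rewrite kernel1_right// !normrM normrX normrN1 expr1n mul1r.
  rewrite !ger0_norm ?exprn_ge0// ?subr_ge0//.
  by rewrite powRM ?exprn_ge0 ?subr_ge0// -powR_mulrn// -powRrM.
rewrite ge0_integralZl//; last 3 first.
- apply/measurable_EFinP; apply: measurable_fun_powRr.
  exact: measurable_funB.
- by move=> t _; rewrite lee_fin powR_ge0.
- by rewrite lee_fin powR_ge0.
rewrite ge0_integralZl//; last 3 first.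
- apply/measurable_EFinP; apply: measurable_fun_powRr.
  exact: measurable_funB.
- by move=> t _; rewrite lee_fin powR_ge0.
- by rewrite lee_fin powR_ge0.
rewrite integral_powR_rsub// integral_powR_subr//.
by rewrite -!EFinM -EFinD /kernel1_moment; congr EFin; ring.
Qed.

Lemma integral_prod (u v : R -> R) :
  measurable_fun setT u -> measurable_fun setT v ->
  (forall t, 0 <= u t) -> (forall s, 0 <= v s) ->
  (\int[leb2]_z (u z.1 * v z.2)%:E
   = (\int[mu]_t (u t)%:E) * (\int[mu]_s (v s)%:E))%E.
Proof.
move=> mu_ mv u0 v0.
have m2 : measurable_fun setT (fun z : R2 => (u z.1 * v z.2)%:E).
  apply/measurable_EFinP; apply: measurable_funM.
    exact: (measurableT_comp mu_ measurable_fst).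
  exact: (measurableT_comp mv measurable_snd).
have p2 z : (0 <= (fun z : R2 => (u z.1 * v z.2)%:E) z)%E.
  by rewrite lee_fin mulr_ge0.
have -> := fubini_tonelli2 (m1 := mu) (m2 := mu) _ m2 p2.
rewrite /fubini_G/=.
have E s : (\int[mu]_t (u t * v s)%:E = (\int[mu]_t (u t)%:E) * (v s)%:E)%E.
  under eq_integral do rewrite EFinM.
  rewrite ge0_integralZr//; first exact/measurable_EFinP.
  - by move=> t _; rewrite lee_fin.
  - by rewrite lee_fin.
under eq_integral do rewrite E.
rewrite ge0_integralZl//.
- exact/measurable_EFinP.
- by move=> s _; rewrite lee_fin.
- by apply: integral_ge0 => t _; rewrite lee_fin.
Qed.

(** S_n is a product of one-variable kernels, so the integral factorizes. *)
Lemma integral_Sn_powR n a b c d x y q : (0 < n)%N ->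
  a <= x <= b -> c <= y <= d -> 0 < q ->
  (\int[leb2]_z (`|(Sn a b c d n x y \_ (rect a b c d)) z| `^ q)%:E
   = ((n`!%:R)^-1 `^ q * kernel1_moment n a b x q * kernel1_moment n c d y q)%:E)%E.
Proof.
move=> n0 xab ycd q0.
pose u a b x := (fun t => `|kernel1 n a b x t| `^ q) \_ `[a, b].
have mu_ a' b' x' : measurable_fun setT (u a' b' x').
  apply/(measurable_restrictT _ _).1 => //.
  apply: measurable_fun_powRr; apply: measurableT_comp => //.
  by apply: measurable_funTS (measurable_kernel1 n a' b' x').
have u0 a' b' x' t : 0 <= u a' b' x' t.
  by rewrite /u patchE; case: ifPn => // _; exact: powR_ge0.
have iu a' b' x' : a' <= x' <= b' ->
    (\int[mu]_t (u a' b' x' t)%:E = (kernel1_moment n a' b' x' q)%:E)%E.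
  move=> x'P; rewrite -(integral_kernel1_powR n0 x'P q0) [RHS]integral_mkcond.
  by apply: eq_integral => t _; rewrite restrict_EFin.
set k := (n`!%:R)^-1 `^ q.
transitivity (\int[leb2]_z (k%:E * (u a b x z.1 * u c d y z.2)%:E))%E.
  apply: eq_integral => -[t s] _; rewrite -EFinM /u !patchE in_setX.
  change ((t, s).1) with t; change ((t, s).2) with s.
  case: (boolP (t \in _)) => tab; case: (boolP (s \in _)) => scd;
    rewrite ?normr0 ?(powR0 (lt0r_neq0 q0)) ?mulr0 ?mul0r ?mulr0//.
    rewrite Sn_kernel1// !normrM ger0_norm ?invr_ge0//.
    by rewrite !powRM ?invr_ge0// mulr_ge0.
rewrite ge0_integralZl//.
- by rewrite integral_prod// !iu// -!EFinM mulrA.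
- apply/measurable_EFinP; apply: measurable_funM.
    exact: (measurableT_comp (mu_ _ _ _) measurable_fst).
  exact: (measurableT_comp (mu_ _ _ _) measurable_snd).
- by move=> z _; rewrite lee_fin mulr_ge0.
- by rewrite lee_fin powR_ge0.
Qed.

(** For a share u in [0, 1] and an exponent th <= 1 one has u <= u ^ th; the two
    shares of A + B add up to 1. *)
Lemma powR_subadditive (A B th : R) : 0 <= A -> 0 <= B -> 0 < th <= 1 ->
  (A + B) `^ th <= A `^ th + B `^ th.
Proof.
move=> A0 B0 /andP[th0 th1].
have [AB0|AB0] := eqVneq (A + B) 0.
  by rewrite AB0 powR0 ?gt_eqF// addr_ge0 ?powR_ge0.
have ABp : 0 < A + B by rewrite lt_neqAle eq_sym AB0 addr_ge0.
have frac C : 0 <= C -> C <= A + B -> C / (A + B) <= (C / (A + B)) `^ th.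
  move=> C0 CAB; have [->|Cn0] := eqVneq C 0; first by rewrite mul0r powR_ge0.
  apply: ger1_powR => //.
  apply/andP; split; last by rewrite ler_pdivrMr// mul1r.
  by rewrite divr_gt0// lt_neqAle eq_sym Cn0.
have fA := frac A A0 ltac:(lra); have fB := frac B B0 ltac:(lra).
have : 1 <= (A / (A + B)) `^ th + (B / (A + B)) `^ th.
  by apply: le_trans (lerD fA fB); rewrite -mulrDl divff.
rewrite !powRM ?invr_ge0 ?addr_ge0// -mulrDl.
rewrite -(ler_pM2r (powR_gt0 th ABp)) mul1r -mulrA -powRM ?invr_ge0 ?addr_ge0//.
by rewrite mulVf// powR1 mulr1.
Qed.

(** The moment is a sum over the two sides of x; subadditivity of the q-th root
    separates them. *)
Lemma kernel1_moment_root n a b x q : a <= x <= b -> 1 <= q ->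
  (kernel1_moment n a b x q) `^ q^-1 <=
  ((b - x) * (x - a) `^ (n%:R + q^-1) + (x - a) * (b - x) `^ (n%:R + q^-1))
  / (n%:R * q + 1) `^ q^-1.
Proof.
move=> /andP[ax xb] q1; have q0 : 0 < q by lra.
have nq : 0 < n%:R * q + 1 by rewrite ltr_wpDl// mulr_ge0// ltW.
have bx : 0 <= b - x by rewrite subr_ge0.
have xa : 0 <= x - a by rewrite subr_ge0.
rewrite /kernel1_moment powRM ?addr_ge0 ?mulr_ge0 ?powR_ge0 ?invr_ge0 ?(ltW nq)//.
have -> : (n%:R * q + 1)^-1 `^ q^-1 = ((n%:R * q + 1) `^ q^-1)^-1.
  by rewrite -[X in X `^ _]powR_inv1 ?ltW// powRAC powR_inv1 ?powR_ge0.
rewrite ler_wpM2r ?invr_ge0 ?powR_ge0//.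
have th : 0 < q^-1 <= 1 by rewrite invr_gt0 q0 invf_le1.
apply: le_trans (powR_subadditive _ _ th) _; rewrite ?mulr_ge0 ?powR_ge0//.
have e : (n%:R * q + 1) * q^-1 = n%:R + q^-1.
  by rewrite mulrDl mul1r -mulrA divff ?mulr1// gt_eqF.
by rewrite !powRM ?powR_ge0// -!powRrM !e divff ?gt_eqF// !powRr1.
Qed.

End kernel_norm.

(** * Bounds on the Stieltjes integral *)

Section bounds.
Context {R : realType}.
Local Notation mu := (@lebesgue_measure R).
Local Notation R2 := (measurableTypeR R * measurableTypeR R)%type.
Variables (a b c d x y : R) (n : nat) (G : R * R -> R) (g : R2 -> R).
Hypotheses (ab : a < b) (cd : c < d) (n0 : (0 < n)%N).
Hypotheses (xab : a <= x <= b) (ycd : c <= y <= d).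
Hypotheses (dG : has_density a b c d G g)
  (g0 : forall z, ~ rect a b c d z -> g z = 0).
Local Notation Q := (rect a b c d).
Local Notation S := (Sn a b c d n x y).

Lemma measurable_Sn : measurable_fun (setT : set R2) (S \_ Q : R2 -> R).
Proof.
have mS : measurable_fun (setT : set R2) (S : R2 -> R).
  rewrite (_ : S = (fun z =>
      (n`!%:R)^-1 * (kernel1 n a b x z.1 * kernel1 n c d y z.2))).
    apply: measurable_funM => //; apply: measurable_funM.
      exact: (measurableT_comp (measurable_kernel1 n a b x) measurable_fst).
    exact: (measurableT_comp (measurable_kernel1 n c d y) measurable_snd).
  by apply/funext => -[t s]; rewrite Sn_kernel1.
apply: (measurable_restrictT _ (measurable_rect a b c d)).1.
exact: (measurable_funS measurableT _ mS).
Qed.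

(** S need not be bounded on the plane; since g vanishes off Q, only its bounded
    restriction matters. *)
Lemma mul_Sn_restrict z : S z * g z = (S \_ Q) z * g z.
Proof.
by rewrite patchE; case: ifPn => // /negP Qz; rewrite g0 ?mulr0// => /mem_set.
Qed.

Lemma integrable_Sn_density : leb2.-integrable setT (fun z => (S z * g z)%:E).
Proof.
under eq_fun do rewrite mul_Sn_restrict EFinM.
apply: integrableMr => //; [exact: measurable_Sn| |exact: dG.1].
have [K1 K10 HK1] := kernel1_bounded n xab.
have [K2 K20 HK2] := kernel1_bounded n ycd.
exists ((n`!%:R)^-1 * (K1 * K2)); split; first exact: num_real.
move=> M KM z _; apply: le_trans (ltW KM); rewrite /= patchE.
case: ifPn => [|_]; last by rewrite normr0 !mulr_ge0 ?invr_ge0.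
case: z => t s; rewrite inE => -[]; rewrite [(t, s).1]/= [(t, s).2]/= => tab scd.
rewrite Sn_kernel1// normrM ger0_norm ?invr_ge0// ler_wpM2l ?invr_ge0//.
by rewrite normrM ler_pM ?HK1 ?HK2.
Qed.

Lemma is_RSint_Sn : is_RSint a b c d S G
  (\int[leb2]_(z in cell a b c d) (S z * g z)).
Proof.
apply: is_RSint_density => //; [exact: Sn_grid_continuous|].
exact: integrable_Sn_density.
Qed.

Lemma RSint_Sn_le : (`|RSint a b c d S G|%:E <=
  'N[leb2]_1[EFin \o ((S \_ Q) \* g)%R])%E.
Proof.
rewrite (RSintE ab cd is_RSint_Sn) Lnorm1.
have mC : measurable (cell a b c d) by exact: measurable_box.
have iC := integrable_box `]a, b] `]c, d] integrable_Sn_density.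
rewrite EFin_normr_Rintegral//.
have mSg := measurable_int _ integrable_Sn_density.
apply: le_trans (le_abse_integral _ mC (measurable_int _ iC)) _.
have E : (fun z => `|(S z * g z)%:E|)%E =
    (fun z => `|(EFin \o ((S \_ Q) \* g)%R) z|)%E.
  by apply/funext => z; rewrite mul_Sn_restrict.
rewrite -[in leRHS]E; apply: ge0_subset_integral => //.
exact: measurableT_comp.
Qed.

Variable D : R2 -> R.
Hypothesis Dg : {ae leb2, forall z, D z = g z}.

(** D stands for the mixed derivative, extended by zero; an essential bound on D
    is one on g. *)
Lemma RSint_Sn_le_Loo : ('N[leb2]_+oo[EFin \o D] < +oo)%E ->
  (`|RSint a b c d S G|%:E <=
   ((n`!%:R)^-1 * kernel1_moment n a b x 1 * kernel1_moment n c d y 1)%:E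
   * 'N[leb2]_+oo[EFin \o D])%E.
Proof.
move=> Dfin; have M0 := Lnorm_ge0 leb2 +oo (EFin \o D).
set M := ('N[leb2]_+oo[EFin \o D])%E in Dfin M0 *.
apply: le_trans RSint_Sn_le _; rewrite Lnorm1.
(* The essential supremum norm is by convention 0 on a null space. *)
have T0 : (0 < leb2 (setT : set R2))%E.
  have mQ := measurable_rect a b c d.
  apply: (@lt_le_trans _ _ (leb2 (rect a b c d))); last first.
    by apply: le_measure; rewrite ?inE.
  rewrite /leb2/= product_measure1E//=.
  rewrite !lebesgue_measure_itv/= !lte_fin ab cd -!EFinD -EFinM lte_fin.
  by rewrite mulr_gt0// subr_gt0.
have gM : {ae leb2, forall z, (`|(g z)%:E| <= M)%E}.
  move: Dg; have := ess_sup_ge leb2 (abse \o (EFin \o D)).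
  rewrite /M unlock /= T0; apply: filterS2 => z Dz <-; exact: Dz.
have mg : measurable_fun setT g.
  by apply/measurable_EFinP; exact: measurable_int dG.1.
have mS := measurable_Sn.
have mSE : measurable_fun setT (fun z : R2 => (`|(S \_ Q) z|)%:E).
  by apply/measurable_EFinP; exact: measurableT_comp.
have <- : (\int[leb2]_z (`|(S \_ Q) z|)%:E
   = ((n`!%:R)^-1 * kernel1_moment n a b x 1 * kernel1_moment n c d y 1)%:E)%E.
  rewrite -[in RHS](@powRr1 R (n`!%:R)^-1) ?invr_ge0// -integral_Sn_powR//.
  by apply: eq_integral => z _; rewrite powRr1.
rewrite -ge0_integralZr//.
apply: ae_ge0_le_integral => //.
- by apply: measurableT_comp => //; apply/measurable_EFinP; exact: measurable_funM.
- by move=> z _; rewrite mule_ge0.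
- exact: emeasurable_funM.
- apply: filterS gM => z gz _; rewrite /= normrM EFinM lee_wpmul2l//.
Qed.

(** Hoelder's inequality is applied to g, which is measurable, and the norm of g
    is then compared with that of D. *)
Lemma RSint_Sn_le_Lp p q : 1 < p -> p^-1 + q^-1 = 1 ->
  (`|RSint a b c d S G|%:E <=
   ((n`!%:R)^-1 * (kernel1_moment n a b x q `^ q^-1)
    * (kernel1_moment n c d y q `^ q^-1))%:E
   * 'N[leb2]_p%:E[EFin \o D])%E.
Proof.
move=> p1 pq.
have p0 : 0 < p by lra.
have qV0 : 0 < q^-1.
  have : p^-1 < 1 by rewrite invf_lt1.
  by move: pq; lra.
have q0 : 0 < q by rewrite -invr_gt0.
apply: le_trans RSint_Sn_le _.
have mg : measurable_fun setT g.
  by apply/measurable_EFinP; exact: measurable_int dG.1.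
have pq' : q^-1 + p^-1 = 1 by rewrite addrC.
apply: le_trans (hoelder leb2 measurable_Sn mg q0 p0 pq') _.
have -> : ('N[leb2]_q%:E[EFin \o (S \_ Q)] = ((n`!%:R)^-1 *
   (kernel1_moment n a b x q `^ q^-1) * (kernel1_moment n c d y q `^ q^-1))%:E)%E.
  rewrite unlock.
  transitivity ((\int[leb2]_z (`|(S \_ Q) z| `^ q)%:E) `^ q^-1)%E.
    by congr poweR; apply: eq_integral => z _.
  rewrite integral_Sn_powR// poweR_EFin.
  move: (kernel1_moment_ge0 n a b x (ltW q0)) (kernel1_moment_ge0 n c d y (ltW q0)).
  move: (kernel1_moment n a b x q) (kernel1_moment n c d y q) => J1 J2 J10 J20.
  rewrite !powRM ?mulr_ge0 ?powR_ge0//.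
  by rewrite -powRrM divff ?gt_eqF// powRr1 ?invr_ge0.
rewrite lee_wpmul2l//; first by rewrite lee_fin !mulr_ge0 ?powR_ge0 ?invr_ge0.
exact: ae_eq_le_Lnorm.
Qed.

End bounds.

Lemma kernel1_moment1 (R : realType) n (a b x : R) : a <= x <= b ->
  kernel1_moment n a b x 1 =
  ((b - x) * (x - a) ^+ n.+1 + (x - a) * (b - x) ^+ n.+1) / n.+1%:R.
Proof.
move=> /andP[ax xb]; rewrite /kernel1_moment mulr1 natr1.
by rewrite !powRr1 ?subr_ge0// !powR_mulrn ?subr_ge0.
Qed.

Lemma le_norm_scaled (R : realType) (C B K L : R) (N : \bar R) :
  0 <= C -> (0 <= N)%E -> C * K <= L ->
  (`|B|%:E <= K%:E * N)%E -> (`|C * B|%:E <= L%:E * N)%E.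
Proof.
move=> C0 N0 CKL BK; rewrite normrM (ger0_norm C0) EFinM.
apply: (@le_trans _ _ (C%:E * (K%:E * N))%E).
  by rewrite lee_wpmul2l// lee_fin.
by rewrite muleA -EFinM lee_wpmul2r// lee_fin.
Qed.

Theorem theorem5 (R : realType) (a b c d : R) (n : nat) (f : R * R -> R)
  (hab : a < b) (hcd : c < d) (hn : (1 <= n)%N)
  (hC : continuous_partials (rect a b c d) n.-1 f)
  (hAC : forall j : nat, (j <= n)%N ->
     pderivable (rect a b c d) (Dword n j) f /\
     abs_cont a b c d (Dnj (rect a b c d) n j f)) :
  forall (x y : R) (k : nat), rect a b c d (x, y) -> (k <= n)%N ->
    [/\ RS_integrable a b c d (Sn a b c d n x y) (Dnj (rect a b c d) n k f),
        LpQ (rect a b c d) +oo%E (Dn1 (rect a b c d) n k f) ->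
        (`|Bn a b c d n k f x y|%:E <=
           (((b - x) * (x - a) ^+ n.+1 + (x - a) * (b - x) ^+ n.+1)
            * ((d - y) * (y - c) ^+ n.+1 + (y - c) * (d - y) ^+ n.+1)
            / (n`!%:R * n.+1%:R ^+ 2 * (b - a) * (d - c)))%:E
           * LnormQ (rect a b c d) +oo (Dn1 (rect a b c d) n k f))%E &
        forall p q : R, 1 < p -> p^-1 + q^-1 = 1 ->
        LpQ (rect a b c d) p%:E (Dn1 (rect a b c d) n k f) ->
        (`|Bn a b c d n k f x y|%:E <=
           (((b - x) * (x - a) `^ (n%:R + q^-1)
             + (x - a) * (b - x) `^ (n%:R + q^-1))
            * ((d - y) * (y - c) `^ (n%:R + q^-1)
               + (y - c) * (d - y) `^ (n%:R + q^-1))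
            / (n`!%:R * (n%:R * q + 1) `^ q^-1 * (b - a) * (d - c)))%:E
           * LnormQ (rect a b c d) p%:E (Dn1 (rect a b c d) n k f))%E].
Proof.
move=> x y k xyQ kn.
have [g dG g0] := abs_cont_density (hAC k kn).2.
have [xab ycd] : a <= x <= b /\ c <= y <= d.
  by case: xyQ; rewrite /= !in_itv.
have Dg (p : \bar R) : LpQ (rect a b c d) p (Dn1 (rect a b c d) n k f) ->
    {ae leb2, forall z, (Dn1 (rect a b c d) n k f \_ (rect a b c d)) z = g z}.
  by move=> [[h mh Dh] _]; exact: ae_mixed_derivative_density dG g0 mh Dh.
have C0 : 0 <= ((b - a) * (d - c))^-1.
  by rewrite invr_ge0 mulr_ge0// subr_ge0 ltW.
have bay : b - a != 0 by rewrite gt_eqF// subr_gt0.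
have dcy : d - c != 0 by rewrite gt_eqF// subr_gt0.
have fy : n`!%:R != 0 :> R by rewrite pnatr_eq0 -lt0n fact_gt0.
split.
- by eexists; exact: (is_RSint_Sn hab hcd hn xab ycd dG g0).
- move=> hL; have [_ fin] := hL.
  apply: (le_norm_scaled C0 _ _
    (RSint_Sn_le_Loo hab hcd hn xab ycd dG g0 (Dg _ hL) fin)).
    exact: Lnorm_ge0.
  rewrite !kernel1_moment1// le_eqVlt; apply/orP; left; apply/eqP.
  have ny : n.+1%:R != 0 :> R by rewrite pnatr_eq0.
  move: (n.+1%:R : R) ny => N ny.
  by field; rewrite bay dcy fy ny.
- move=> p q p1 pq hL.
  apply: (le_norm_scaled C0 _ _
    (RSint_Sn_le_Lp hab hcd hn xab ycd dG g0 (Dg _ hL) p1 pq)).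
    exact: Lnorm_ge0.
  have q1 : 1 <= q.
    have p0 : 0 < p^-1 by rewrite invr_gt0; lra.
    have p1' : p^-1 < 1 by rewrite invf_lt1//; lra.
    have q0 : 0 < q^-1 by lra.
    rewrite -[q]invrK -(invr1 R) lef_pV2 ?posrE//; lra.
  have J1 := kernel1_moment_root n xab q1.
  have J2 := kernel1_moment_root n ycd q1.
  have q0 : 0 < q by lra.
  have w1 : 1 <= (n%:R * q + 1) `^ q^-1.
    apply: (@le_trans _ _ (1 `^ q^-1)); first by rewrite powR1.
    apply: ge0_ler_powR; rewrite ?nnegrE//.
    + by rewrite invr_ge0 ltW.
    + by rewrite addr_ge0// mulr_ge0// ltW.
    + by rewrite lerDr mulr_ge0// ltW.
  have X0 u v r : u <= r <= v ->
      0 <= (v - r) * (r - u) `^ (n%:R + q^-1) + (r - u) * (v - r) `^ (n%:R + q^-1).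
    by move=> /andP[ur rv]; rewrite addr_ge0// mulr_ge0 ?powR_ge0// subr_ge0.
  move: J1 J2 (X0 _ _ _ xab) (X0 _ _ _ ycd) w1.
  set X := (b - x) * _ + _; set Y := (d - y) * _ + _.
  move: ((n%:R * q + 1) `^ q^-1) => w.
  move: (powR_ge0 (kernel1_moment n a b x q) q^-1).
  move: (powR_ge0 (kernel1_moment n c d y q) q^-1).
  move: (kernel1_moment n a b x q `^ q^-1) (kernel1_moment n c d y q `^ q^-1).
  move=> j1 j2 j20 j10 J1 J2 Xge0 Yge0 w1.
  have wy : w != 0 by rewrite gt_eqF//; lra.
  (* One of the two factors w coming from the two variables is given up. *)
  have Yw : Y / w <= Y by rewrite ler_pdivrMr ?ler_peMr//; lra.
  have -> : X * Y / (n`!%:R * w * (b - a) * (d - c)) =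
      ((b - a) * (d - c))^-1 * ((n`!%:R)^-1 * (X / w) * Y).
    by field; rewrite bay dcy fy wy.
  rewrite ler_wpM2l// -!mulrA ler_wpM2l ?invr_ge0//.
  by rewrite mulrA ler_pM// (le_trans J2).
Qed.
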